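(* Let $p>0$ be a prime, $k$ a field of characteristic $p$, $n\ge 3$, $R=k[x_1,\ldots,x_n]$ and $f=x_1+\cdots+x_n$. (I) Let $q=p^e$ ($e\ge 0$) be a power of $p$, and for $i=1,\ldots,n+1$ let $0\le r_i\le q-1$, $1\le k_i\le p-1$ be integers and $d_i=k_iq+r_i$. Assume that $$k_i\le \left\lfloor \frac{\sum_{j=1}^{n+1}k_j-n+1}{2}\right\rfloor\quad\text{for all } i\in\{1,\ldots,n+1\}.$$ Then $$\mathcal{E}_p(d_1,\ldots,d_{n+1})=\min\Big\{q\,\mathcal{E}_p(k_1+\epsilon_1,\ldots,k_{n+1}+\epsilon_{n+1})+\sum_{i:\,\epsilon_i=0}r_i\Big\},$$ where the minimum is taken over all $(\epsilon_1,\ldots,\epsilon_{n+1})\in\{0,1\}^{n+1}$. (II) Let $1\le\kappa_1,\ldots,\kappa_{n+1}\le p$ be integers such that $$\kappa_i\le\left\lfloor\frac{\sum_{j=1}^{n+1}\kappa_j-n+1}{2}\right\rfloor\quad\text{for all } i\in\{1,\ldots,n+1\}.$$ Then $$\mathcal{E}_p(\kappa_1,\ldots,\kappa_{n+1})=\min\left\{\left\lceil\frac{\sum_{i=1}^{n+1}\kappa_i-n+1}{2}\right\rceil,\ p\right\}.$$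
   Context: Let $k$ be a field of characteristic $p$, and $f:=x_1+\cdots+x_n\in k[x_1,\ldots,x_n]$ (standard grading). For positive integers $d_1,\ldots,d_{n+1}$, a (homogeneous) relation on $x_1^{d_1},\ldots,x_n^{d_n},f^{d_{n+1}}$ is a tuple $\mathcal{A}=(a_1,\ldots,a_{n+1})^t$ of homogeneous polynomials with $a_1x_1^{d_1}+\cdots+a_nx_n^{d_n}+a_{n+1}f^{d_{n+1}}=0$ (all terms of the same degree). Its degree is $\deg(\mathcal{A}):=\deg(a_i)+d_i$ (independent of $i$ with $a_i\neq 0$). Writing $x_{n+1}:=f$, the relation is non-Koszul if $a_i\notin (x_j^{d_j}: j\ne i,\ 1\le j\le n+1)$ for some (equivalently for all) $i\in\{1,\ldots,n+1\}$. $\mathcal{E}_p(d_1,\ldots,d_{n+1})$ denotes the minimum of $\deg(\mathcal{A})$ over all non-Koszul relations $\mathcal{A}$; it depends on $k$ only through its characteristic $p$. *)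

(* Defs.v *)
From Stdlib Require Import Classical ClassicalEpsilon.
From mathcomp Require Import all_boot all_algebra.
From mathcomp.multinomials Require Import mpoly.

Set Implicit Arguments.
Unset Strict Implicit.
Unset Printing Implicit Defensive.

Import GRing.Theory.
Local Open Scope ring_scope.

Definition is_min_of (P : nat -> Prop) (m : nat) : Prop :=
  P m /\ (forall m', P m' -> (m <= m')%N).

Lemma is_min_of_ex (P : nat -> Prop) m : P m -> exists m', is_min_of P m'.
Proof.
have [b] := ubnP m; elim: b m => // b IHb m; rewrite ltnS => le_mb Pm.
have [[m' [Pm' lt_m'm]]|noP] := classic (exists m', P m' /\ (m' < m)%N).
  exact: IHb (leq_trans lt_m'm le_mb) Pm'.
exists m; split=> // m' Pm'; rewrite leqNgt; apply/negP => lt_m'm.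
by apply: noP; exists m'.
Qed.

(* The minimum of a set of naturals; unspecified if the set is empty. *)
Definition nat_min (P : nat -> Prop) : nat :=
  epsilon (inhabits 0%N) (is_min_of P).

Lemma nat_minP (P : nat -> Prop) : (exists m, P m) -> is_min_of P (nat_min P).
Proof. by case=> m /is_min_of_ex; apply: epsilon_spec. Qed.

Section Relations.
Variables (k : fieldType) (n : nat).
Implicit Types (d : 'I_n.+1 -> nat) (a : 'I_n.+1 -> {mpoly k[n]}).

(* The n + 1 linear forms x_1, ..., x_n, f = x_1 + ... + x_n, with f in
   position ord_max and x_j in position lift ord_max j. *)
Definition xf (i : 'I_n.+1) : {mpoly k[n]} :=
  if unlift ord_max i is Some j then 'X_j else \sum_(j < n) 'X_j.

(* A zero entry carries no degree constraint; the zero relation has every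
   degree, but it is Koszul. *)
Definition is_relation d (D : nat) a : Prop :=
  (forall i, a i != 0 -> exists2 e, a i \is e.-homog & (e + d i)%N = D) /\
  \sum_(i < n.+1) a i * xf i ^+ d i = 0.

(* p belongs to the ideal generated by the xf j ^+ d j with j != i. *)
Definition in_ideal_but d (i : 'I_n.+1) (p : {mpoly k[n]}) : Prop :=
  exists b : 'I_n.+1 -> {mpoly k[n]},
    p = \sum_(j < n.+1 | j != i) b j * xf j ^+ d j.

(* For a relation a on the xf i ^+ d i, "some i" is equivalent to "every i". *)
Definition non_Koszul d a : Prop := exists i, ~ in_ideal_but d i (a i).

(* The minimal degree of a non-Koszul relation; the minimum is attained when
   all d i are positive, see EpP. *)
Definition Ep d : nat :=
  nat_min (fun D => exists a, is_relation d D a /\ non_Koszul d a).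

Let xf_max : xf ord_max = \sum_(j < n) 'X_j.
Proof. by rewrite /xf unlift_none. Qed.

Let xf_lift j : xf (lift ord_max j) = 'X_j.
Proof. by rewrite /xf liftK. Qed.

Let widen_lift (j : 'I_n) : widen_ord (leqnSn n) j = lift ord_max j.
Proof. by apply: val_inj; rewrite /= /bump leqNgt ltn_ord. Qed.

(* The socle generator of k[x]/(x_1^d_1, ..., x_n^d_n) gives a relation. *)
Lemma non_Koszul_ex d : (forall i, 0 < d i)%N ->
  exists D a, is_relation d D a /\ non_Koszul d a.
Proof.
move=> d_gt0; pose c (j : 'I_n) := (d (lift ord_max j)).-1.
pose mo (j : 'I_n) := \prod_(l < n | l != j) ('X_l : {mpoly k[n]}) ^+ c l.
pose m : {mpoly k[n]} := \prod_(l < n) 'X_l ^+ c l.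
pose f : {mpoly k[n]} := \sum_(j < n) 'X_j.
pose a i := if unlift ord_max i is Some j
            then - (f ^+ (d ord_max).-1 * mo j) else m.
have homX (l : 'I_n) : ('X_l : {mpoly k[n]}) \is 1.-homog.
  by rewrite dhomogX /= mdeg1.
have homf : f \is 1.-homog by apply: rpred_sum => j _.
have homXn (p : {mpoly k[n]}) e : p \is 1.-homog -> p ^+ e \is e.-homog.
  by move=> /(@dhomogMn _ _ _ _ _ e); rewrite mul1n.
have homP (P : pred 'I_n) :
    \prod_(l < n | P l) ('X_l : {mpoly k[n]}) ^+ c l
      \is (\sum_(l < n | P l) c l)%N.-homog.
  elim/big_rec2: _ => [|l p e _ IH]; first exact: dhomog1.
  exact/dhomogM/IH/homXn.
exists ((\sum_(l < n) c l) + d ord_max)%N, a; split; first split.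
- move=> i _; rewrite /a; case: unliftP => [j ->|->]; last first.
    by exists (\sum_(l < n) c l)%N => //; apply: homP.
  exists ((d ord_max).-1 + \sum_(l < n | l != j) c l)%N.
    by rewrite rpredN; apply: dhomogM; [apply: homXn | apply: homP].
  have dj : d (lift ord_max j) = (c j).+1 by rewrite /c prednK.
  rewrite dj -[in RHS](prednK (d_gt0 ord_max)) [in RHS](bigD1 j) //= !addnS.
  by congr _.+1; rewrite [LHS]addnAC [RHS]addnAC [(c j + _)%N]addnC.
- rewrite big_ord_recr /= xf_max /a unlift_none.
  have mE j : mo j * 'X_j ^+ d (lift ord_max j) = m * 'X_j.
    rewrite -[d (lift _ _)]prednK // exprS mulrCA -/(c j) [RHS]mulrC.
    by congr (_ * _); rewrite mulrC /m (bigD1 j).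
  under eq_bigr => j _ do
    rewrite widen_lift liftK xf_lift mulNr -mulrA mE.
  rewrite sumrN -2!mulr_sumr -/f mulrA [_ * m]mulrC -mulrA -exprSr.
  by rewrite prednK // addNr.
exists ord_max; rewrite /a unlift_none => -[b].
rewrite big_mkcond big_ord_recr /= eqxx addr0 => Em.
pose M := [multinom c l | l < n].
have EM : m = 'X_[M].
  by rewrite mpolyXE_id; apply: eq_bigr => l _; rewrite mnmE.
have /eqP := congr1 (mcoeff M) Em; rewrite EM mcoeffX eqxx raddf_sum /= big1.
  by rewrite oner_eq0.
move=> j _; case: ifP => [_|]; last by rewrite mcoeff0.
rewrite widen_lift xf_lift mcoeffM big1 // => -[m1 m2] /= /eqP EMs.
rewrite mcoeffXn; case: eqP => [Em2|]; last by rewrite mulr0.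
have := congr1 (fun x : 'X_{1..n} => x j) EMs; rewrite -Em2.
rewrite mnmE mnmDE mulmnE mnm1E eqxx mul1n /c => Ec.
by have := d_gt0 (lift ord_max j); rewrite -ltn_predL Ec ltnNge leq_addl.
Qed.

Lemma EpP d : (forall i, 0 < d i)%N ->
  is_min_of (fun D => exists a, is_relation d D a /\ non_Koszul d a) (Ep d).
Proof. by move=> /non_Koszul_ex; apply: nat_minP. Qed.

End Relations.

(* Main.v *)
Require Import Defs.
From mathcomp Require Import all_boot all_algebra.
From mathcomp.multinomials Require Import mpoly.
From mathcomp Require Import zify ring.
From Stdlib Require Import Classical.

Set Implicit Arguments.
Unset Strict Implicit.
Unset Printing Implicit Defensive.

Import GRing.Theory.
Local Open Scope ring_scope.

(** The proof works in m = n + 1 variables.  Let S be the sum of the variables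
    X_0, ..., X_n and A(d) the quotient of k[X_0, ..., X_n] by the X_i^(d i).
    Modulo S the last variable is, up to sign, the sum of the others, so a
    non-Koszul relation of degree D + 1 amounts to a nonzero element of degree
    D of A(d) killed by S ([relation_not_inj], [not_inj_relation]).  Hence
    [Ep k d] is one more than the least degree in which multiplication by S on
    A(d) fails to be injective, and the n + 1 exponents play symmetric roles.

    Part (II).  Multiplication by S has an adjoint, the lowering operator of an
    action of sl_2, whose commutation relations have integer coefficients; in
    degrees below p, and up to the middle degree, they force injectivity
    ([inj_mulS_lefschetz]).  Conversely S^(p-1) is killed by S because S^p is
    the sum of the X_i^p, and by Macaulay duality an element just above the
    middle degree killed by S is a polynomial killed by the sum of the partial
    derivatives.  A product of differences of variables is one, and the
    balancing condition says that a multigraph with prescribed degree bounds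
    has enough edges for it ([multigraph], [not_inj_mulS_edges]).  The balancing
    condition of [Ep_small] is slightly weaker than that of the theorem, so that
    it still holds at all the corners k + eps.

    Part (I), upper bound.  Raising a relation to the q-th power multiplies its
    degree and its exponents by q, and [Ep] is monotone and 1-Lipschitz in each
    exponent ([Ep_le_corner]).

    Part (I), lower bound.  For natural numbers K_i whose sum has the parity of m, let
    V(K) be q (sum_i K_i - n + 1) / 2 + sum_i max(d_i - q K_i, 0); when
    K = k + eps and the minimum of part (II) is not p, this is the value attached
    to eps in the theorem.  Call W_q(d) the minimum of all V(K).  What has to be
    shown is that S is injective in degree D as soon as D + 1 is less than p q
    and than W_q(d) ([below_corners]).  Let c be killed by S.

    Write exponents in base q.  As S^q is the sum of the X_i^q, the monomials
    of c with given remainders modulo q define an element killed by the sum of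
    the variables in a quotient A(k'), where k'_i is k_i or k_i + 1, and part
    (II) kills it in low degree.  Geometrically, each axis is cut into segments
    at the multiples of q and at the integers congruent to r_i, the level of a
    monomial counts the segments before it, and c vanishes at levels below
    sum_i k_i ([vanish_low_level]).  On a cell of level sum_i k_i no term of
    S c can then come through the walls, so the restriction of c is killed by S
    in A(b), where the b_i are the side lengths of the cell, at most q; and the
    degree of this restriction plus one is less than W_q(b) ([seg_corners]).
    For odd p and m >= 4 one has W_(q/p) >= W_q ([below_corners_refine]), and
    W_q(b) <= q, so that induction on the exponent of q applies.  At level one
    more, the degree is less than a side of the cell, where S is injective for
    trivial reasons ([inj_mulS_free]), and higher levels do not occur
    ([vanish_digits]).

    For p = 2 all the k_i are 1 and the comparison of W_(q/p) with W_q breaks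
    down, but the only cell left has sides q - r_i and degree at most
    2 q - 2 - sum_i r_i.  There already three of the variables force injectivity,
    by a computation in k[x] with (1 + x)^q = 1 + x^q ([poly_window]). *)

(** * Multiplication by the sum of the variables in a truncated polynomial ring *)

Section Multiplication.
Variables (R : comNzRingType) (m : nat).
Implicit Types (c : 'X_{1..m} -> R) (d : 'I_m -> nat) (mu nu : 'X_{1..m}).

(** A function [c] on exponents stands for the polynomial or power series with these
    coefficients.  The exponents of [box d] form the monomial basis of the quotient by
    the X_i^(d i), so [vanish d D c] means that the component of degree D of [c] is
    zero there. *)
Definition box d mu : Prop := forall i, (mu i < d i)%N.

Definition vanish d D c : Prop := forall mu, box d mu -> mdeg mu = D -> c mu = 0.

Definition mulX (i : 'I_m) c mu : R :=
  if mu i == 0%N then 0 else c (mu - U_(i))%MM.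

Definition mulS c mu : R := \sum_(i < m) mulX i c mu.

(** Injectivity, on the component of degree D of the quotient by the X_i^(d i), of the
    multiplication by the t-th power of the sum of the variables. *)
Definition inj_mulS d (t D : nat) : Prop :=
  forall c, vanish d (D + t) (iter t mulS c) -> vanish d D c.

Lemma eq_mulX i c c' : c =1 c' -> mulX i c =1 mulX i c'.
Proof. by move=> eqc mu; rewrite /mulX eqc. Qed.

Lemma eq_mulS c c' : c =1 c' -> mulS c =1 mulS c'.
Proof. by move=> eqc mu; apply: eq_bigr => i _; apply: eq_mulX. Qed.

Lemma mulXD i c mu : mulX i c (mu + U_(i))%MM = c mu.
Proof. by rewrite /mulX mnmDE mnm1E eqxx addn1 /= addmK. Qed.

Lemma box_sub d mu i : box d mu -> box d (mu - U_(i))%MM.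
Proof. by move=> bmu j; rewrite mnmBE; apply: leq_ltn_trans (bmu j); apply: leq_subr. Qed.

Lemma submU mu i : (0 < mu i)%N -> (mu - U_(i) + U_(i))%MM = mu.
Proof. by move=> mui; rewrite submK // lep1mP -lt0n. Qed.

Lemma mdeg_subU mu i : (0 < mu i)%N -> (mdeg (mu - U_(i))%MM).+1 = mdeg mu.
Proof. by move=> mui; rewrite -{2}(submU mui) mdegD mdeg1 addn1. Qed.

Lemma mulX_comm i j c : mulX i (mulX j c) =1 mulX j (mulX i c).
Proof.
move=> mu; rewrite /mulX !mnmBE !mnm1E [j == i]eq_sym.
have [->//|neq_ij] := eqVneq i j.
rewrite !subn0 !submDA [(U_(j) + _)%MM]addmC.
by case: (mu i == _); case: (mu j == _).
Qed.

Lemma mulX_sum i (c_ : 'I_m -> 'X_{1..m} -> R) mu :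
  mulX i (fun nu => \sum_(l < m) c_ l nu) mu = \sum_(l < m) mulX i (c_ l) mu.
Proof. by rewrite /mulX; case: ifP => // _; rewrite big1. Qed.

Lemma mulS_mulX i c : mulS (mulX i c) =1 mulX i (mulS c).
Proof.
by move=> mu; rewrite mulX_sum; apply: eq_bigr => l _; apply: mulX_comm.
Qed.

Lemma iter_mulS_mulX t i c : iter t mulS (mulX i c) =1 mulX i (iter t mulS c).
Proof.
elim: t => //= t IHt mu; rewrite (eq_mulS IHt); exact: mulS_mulX.
Qed.

Lemma mulS_lin a c c' mu :
  mulS (fun nu => c nu + a * c' nu) mu = mulS c mu + a * mulS c' mu.
Proof.
rewrite /mulS mulr_sumr -big_split; apply: eq_bigr => i _ /=; rewrite /mulX.
by case: ifP; rewrite // mulr0 addr0.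
Qed.

Lemma iter_mulS_lin t a c c' mu :
  iter t mulS (fun nu => c nu + a * c' nu) mu
    = iter t mulS c mu + a * iter t mulS c' mu.
Proof.
elim: t mu => //= t IHt mu; rewrite (eq_mulS IHt); exact: mulS_lin.
Qed.

Definition agree d D c c' : Prop :=
  forall mu, box d mu -> mdeg mu = D -> c mu = c' mu.

Lemma agree_mulS d D c c' : agree d D c c' -> agree d D.+1 (mulS c) (mulS c').
Proof.
move=> ag mu bmu dmu; apply: eq_bigr => i _; rewrite /mulX.
case: ifP => // /negbT; rewrite -lt0n => mui; apply: ag; first exact: box_sub.
by apply/succn_inj; rewrite mdeg_subU.
Qed.

Lemma agree_iter d D t c c' :
  agree d D c c' -> agree d (D + t) (iter t mulS c) (iter t mulS c').
Proof.
by move=> ag; elim: t => [|t IHt]; rewrite ?addn0 ?addnS //; apply: agree_mulS.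
Qed.

Lemma iter_mulS0 t mu : iter t mulS (fun=> 0) mu = 0.
Proof.
elim: t mu => //= t IHt mu; rewrite (eq_mulS IHt) /mulS big1 // => i _.
by rewrite /mulX; case: ifP.
Qed.

Lemma vanish_iter d D t c : vanish d D c -> vanish d (D + t) (iter t mulS c).
Proof.
move=> van mu bmu dmu; rewrite -(iter_mulS0 t mu).
exact: (@agree_iter d D t c (fun=> 0)).
Qed.

Lemma eq_box d d' mu : d =1 d' -> box d mu -> box d' mu.
Proof. by move=> eqd bmu i; rewrite -eqd. Qed.

Lemma eq_inj_mulS d d' t D : d =1 d' -> inj_mulS d t D -> inj_mulS d' t D.
Proof.
move=> eqd inj c van mu bmu; apply: (inj c) => [nu bnu|].
  by apply: van; apply: eq_box bnu.
by apply: eq_box bmu => i.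
Qed.

(** An element of the kernel for [d] which dies for the smaller exponents is X_i0 times
    an element of degree one less, and X_i0 may be cancelled when the exponent d i0
    is lowered by one. *)
Lemma inj_mulS_incr d i0 t D : (1 < d i0)%N ->
  inj_mulS (fun i => d i - (i == i0))%N t D ->
  (forall D', D = D'.+1 -> inj_mulS (fun i => d i - (i == i0))%N t D') ->
  inj_mulS d t D.
Proof.
set d' := fun i => _ => di0 inj inj1 c van.
have sub nu : box d' nu -> box d nu.
  by move=> bnu i; apply: leq_trans (bnu i) (leq_subr _ _).
(* The kernel already vanishes for the smaller exponents; c1 below is the quotient by
X_i0 of what remains. *)
have van' : vanish d' D c by apply: inj => nu /sub; apply: van.
have box_iff mu : box d mu -> (mu i0 < (d i0).-1)%N -> box d' mu.
  move=> bmu mui i; rewrite /d'; case: eqP => [->|_]; last by rewrite subn0.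
  by rewrite subn1.
move=> mu bmu dmu; have [mui|mui] := ltnP (mu i0) (d i0).-1.
  by apply: van' => //; apply: box_iff.
have mui0 : (0 < mu i0)%N by lia.
have [D' eD] : exists D', D = D'.+1.
  by exists (mdeg (mu - U_(i0))%MM); rewrite mdeg_subU.
pose c1 nu := c (nu + U_(i0))%MM.
have boxD nu : box d' nu -> box d (nu + U_(i0))%MM.
  move=> bnu i; have := bnu i; rewrite /d' mnmDE mnm1E [i0 == _]eq_sym.
  by case: eqP => [->|_]; lia.
have ag : agree d D (mulX i0 c1) c.
  move=> nu bnu dnu; rewrite /mulX /c1; case: eqP => [nui|/eqP].
    by rewrite van' //; apply: box_iff; rewrite // nui; lia.
  by rewrite -lt0n => nui; rewrite submU.
have van1 : vanish d' D' c1.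
  apply: inj1 => // nu bnu dnu; rewrite -(mulXD i0) -iter_mulS_mulX.
  have dnuU : mdeg (nu + U_(i0))%MM = (D + t)%N.
    by rewrite mdegD mdeg1 dnu eD addn1 addSn.
  by rewrite (agree_iter ag) ?van //; apply: boxD.
rewrite -(submU mui0); apply: van1.
  move=> i; have := bmu i; rewrite /d' mnmBE mnm1E [i0 == _]eq_sym.
  by case: eqP => [->|_]; lia.
by apply/succn_inj; rewrite mdeg_subU // dmu eD.
Qed.

Lemma inj_mulS_mono d d' t D : (forall i, 0 < d' i <= d i)%N ->
  (forall D', (D' <= D)%N -> inj_mulS d' t D') -> inj_mulS d t D.
Proof.
have [s] := ubnP (\sum_i d i)%N; elim: s => // s IHs in d D *; rewrite ltnS => leds.
move=> led injd'; have [eqd|/forallPn[i0 ned]] := boolP [forall i, d i == d' i].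
  by apply: eq_inj_mulS (injd' D _) => // i; apply/esym/eqP/(forallP eqd).
have lti : (d' i0 < d i0)%N by have := led i0; lia.
have d'i : (0 < d' i0)%N by have /andP[] := led i0.
have IH D' : (D' <= D)%N -> inj_mulS (fun i => d i - (i == i0))%N t D'.
  move=> leD; apply: IHs => [|i|D'' leD']; last exact/injd'/(leq_trans leD').
    apply: leq_trans leds; rewrite (bigD1 i0) //= [X in (_ < X)%N](bigD1 i0) //=.
    rewrite eqxx -addSn leq_add //; first by lia.
    by apply: leq_sum => i _; apply: leq_subr.
  by have := led i; case: eqP => [->|_]; lia.
apply: (@inj_mulS_incr d i0); first by lia.
  exact: IH.
by move=> D' eD; apply: IH; lia.
Qed.

(** Multiplication by X_i0 embeds the quotient for [d] into the one for the larger
    exponents and commutes with the sum of the variables. *)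
Lemma inj_mulS_decr d i0 D :
  inj_mulS (fun i => d i + (i == i0))%N 1 D.+1 -> inj_mulS d 1 D.
Proof.
move=> inj c van mu bmu dmu; rewrite -(mulXD i0); apply: inj.
- move=> nu bnu dnu; rewrite [iter _ _ _ _]mulS_mulX /mulX; case: ifP => // /negbT.
  rewrite -lt0n => nui; apply: van.
    move=> i; have := bnu i; rewrite mnmBE mnm1E [i0 == _]eq_sym.
    by case: eqP => [->|_]; lia.
  by apply/succn_inj; rewrite mdeg_subU // dnu addSn.
- move=> i; have := bmu i; rewrite mnmDE mnm1E [i0 == _]eq_sym.
  by case: eqP => [->|_]; lia.
- by rewrite mdegD mdeg1 dmu addn1.
Qed.

(** In degree at most D + 1 the variable X_j is not truncated, so the vanishing of the
    product expresses each coefficient through coefficients with a larger exponent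
    of X_j. *)
Lemma inj_mulS_free d j D : (D.+1 < d j)%N -> inj_mulS d 1 D.
Proof.
move=> dj c van mu bmu dmu.
have [s] := ubnP (D - mu j)%N; elim: s => // s IHs in mu bmu dmu *.
rewrite ltnS => les.
have muj : (mu j <= D)%N by rewrite -dmu mdegE (bigD1 j) //= leq_addr.
have bmuD : box d (mu + U_(j))%MM.
  by move=> i; rewrite mnmDE mnm1E; case: eqP => [<-|_]; have := bmu i; lia.
have dmuD : mdeg (mu + U_(j))%MM = D.+1 by rewrite mdegD mdeg1 dmu addn1.
have := van _ bmuD; rewrite dmuD addn1 => /(_ erefl) /=.
rewrite /mulS (bigD1 j) //= mulXD big1 ?addr0 // => i neq_ij.
rewrite /mulX; case: ifP => // /negbT; rewrite -lt0n => nui.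
have muji : (mu + U_(j) - U_(i))%MM j = (mu j).+1.
  by rewrite mnmBE mnmDE !mnm1E eqxx (negbTE neq_ij) subn0 addn1.
have dmui : mdeg (mu + U_(j) - U_(i))%MM = D.
  by apply/succn_inj; rewrite mdeg_subU.
have : ((mu + U_(j) - U_(i))%MM j <= D)%N.
  by rewrite -[X in (_ <= X)%N]dmui mdegE (bigD1 j) //= leq_addr.
rewrite muji => lt_mujD; apply: IHs; rewrite ?muji //; last by lia.
exact: box_sub.
Qed.

End Multiplication.

Arguments mulS {R m} c mu.

(** * Injectivity in small degrees *)

Section Lowering.
Variables (F : fieldType) (m : nat).
Implicit Types (c : 'X_{1..m} -> F) (d : 'I_m -> nat) (mu nu : 'X_{1..m}).

(** The lowering operator of sl_2 on a tensor product of representations of dimensions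
    d i, normalised so that multiplication by the sum of the variables is the raising
    operator.  It preserves the ideal of the X_i^(d i) since the coefficient vanishes
    at exponent d i. *)
Definition lower d c mu : F :=
  \sum_(i < m) (mu i).+1%:R * ((d i)%:R - (mu i).+1%:R) * c (mu + U_(i))%MM.

Lemma lower_vanish d D c : vanish d D.+1 c -> vanish d D (lower d c).
Proof.
move=> van mu bmu dmu; rewrite /lower big1 // => i _.
have [mui|mui] := ltnP (mu i).+1 (d i).
  rewrite van ?mulr0 //; last by rewrite mdegD mdeg1 dmu addn1.
  by move=> j; rewrite mnmDE mnm1E; case: eqP => [<-|_]; rewrite ?addn1 // addn0.
have -> : d i = (mu i).+1 by apply/eqP; rewrite eqn_leq mui (bmu i).
by rewrite subrr mulr0 mul0r.
Qed.

(** The commutator of lowering and raising operators acts on degree D as the weight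
    sum_i (d i - 1) - 2 D. *)
Lemma lower_mulS d c mu :
  lower d (mulS c) mu = mulS (lower d c) mu
    + ((\sum_(i < m) d i)%:R - m%:R - (mdeg mu)%:R *+ 2) * c mu.
Proof.
have -> : (\sum_(i < m) d i)%:R - m%:R - (mdeg mu)%:R *+ 2
            = \sum_(i < m) ((d i)%:R - 1 - (mu i)%:R *+ 2) :> F.
  by rewrite mdegE !natr_sum -sumrMnl !sumrB sumr_const card_ord.
rewrite mulr_suml; pose T i l nu := (nu i).+1%:R * ((d i)%:R - (nu i).+1%:R)
  * mulX l c (nu + U_(i))%MM.
have -> : lower d (mulS c) mu = \sum_(i < m) \sum_(l < m) T i l mu.
  by apply: eq_bigr => i _; rewrite /T -mulr_sumr.
have -> : mulS (lower d c) mu = \sum_(l < m) \sum_(i < m) mulX l (fun nu =>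
    (nu i).+1%:R * ((d i)%:R - (nu i).+1%:R) * c (nu + U_(i))%MM) mu.
  by apply: eq_bigr => l _; rewrite -mulX_sum.
rewrite exchange_big -big_split; apply: eq_bigr => l _ /=.
rewrite (bigD1 l) //= [in RHS](bigD1 l) //= addrAC.
congr (_ + _).
  rewrite /T mulXD /mulX; case: eqP => [->|/eqP].
    by rewrite mul1r add0r mul0rn subr0.
  rewrite -lt0n => mul; rewrite submU // mnmBE mnm1E eqxx subn1 prednK //.
  rewrite -mulrDl; congr (_ * _); rewrite -[(mu l).+1]addn1 !natrD.
  by ring.
apply: eq_bigr => i neq_il; rewrite /T /mulX mnmDE mnmBE !mnm1E.
rewrite (negbTE neq_il) [l == i]eq_sym (negbTE neq_il) addn0 subn0.
case: eqP => [_|/eqP]; first by rewrite mulr0.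
rewrite -lt0n => mul; congr (_ * c _); apply/mnmP => j.
rewrite !(mnmBE, mnmDE, mnm1E); move: mul neq_il.
by have [<-|_] := eqVneq l j; case: eqVneq => //= *; lia.
Qed.

Lemma lower_iter d t c mu D : (mdeg mu + 1 = D + t)%N ->
  lower d (iter t mulS c) mu = iter t mulS (lower d c) mu
    + t%:R * ((\sum_(i < m) d i)%:R - m%:R - D%:R *+ 2 - t%:R + 1)
        * iter t.-1 mulS c mu.
Proof.
elim: t mu => [|t IHt] mu dmu; first by rewrite !mul0r addr0.
rewrite [LHS]lower_mulS; set s := _ - m%:R.
have dmuE : mdeg mu = (D + t)%N by lia.
have -> : mulS (lower d (iter t mulS c)) mu = mulS (fun nu =>
    iter t mulS (lower d c) nu + t%:R * (s - D%:R *+ 2 - t%:R + 1)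
        * iter t.-1 mulS c nu) mu.
  apply: eq_bigr => i _; rewrite /mulX; case: ifP => // /negbT; rewrite -lt0n => mui.
  by apply: IHt; have := mdeg_subU mui; lia.
rewrite mulS_lin -addrA; congr (_ + _).
have -> : t%:R * (s - D%:R *+ 2 - t%:R + 1) * mulS (iter t.-1 mulS c) mu
          = t%:R * (s - D%:R *+ 2 - t%:R + 1) * iter t mulS c mu.
  by case: (t) => [|t'] //; rewrite !mul0r.
rewrite -mulrDl dmuE; congr (_ * _); rewrite -[t.+1]addn1 !natrD.
by ring.
Qed.

(** Up to the middle degree S^t is injective as long as degrees stay below p.  If there
    is room (2 D + t smaller than the socle degree) lower some exponent by one and use
    [inj_mulS_incr].  In the extremal case the scalar in [lower_iter] is t, which is
    invertible modulo p: from S^t c = 0 one gets that S L c + t c is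
    killed by S^(t-1), where L is the lowering operator, hence is zero, and then that
    S^(t+1) kills L c, of degree one less; so L c = 0 and c = 0.  The sum
    D + t never increases in this induction. *)
Lemma inj_mulS_lefschetz p d t D : p \in [pchar F] -> (forall i, 0 < d i)%N ->
  (D + t < p)%N -> (D.*2 + t + m <= \sum_(i < m) d i)%N -> inj_mulS F d t D.
Proof.
move=> charp; pose ok d t D := [/\ forall i, (0 < d i)%N, (D + t < p)%N
  & (D.*2 + t + m <= \sum_(i < m) d i)%N].
suff step D0 : (forall D', D0 = D'.+1 -> forall t d, ok d t D' -> inj_mulS F d t D') ->
    forall t d, ok d t D0 -> inj_mulS F d t D0.
  move=> d0 ltp leD; have okD : ok d t D by [].
  elim: D t d okD {d0 ltp leD} => [|D IHD]; apply: step => // D' [<-].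
  exact: IHD.
move=> {D t d} IHD; elim=> [|t IHt] d.
  by move=> _ c; rewrite addn0.
have [s] := ubnP (\sum_(i < m) d i)%N; elim: s d => // s IHs d; rewrite ltnS => leds.
case=> d0 ltp; rewrite leq_eqVlt => /orP[/eqP eqD|ltD]; last first.
  have [i0 di0] : exists i, (1 < d i)%N.
    apply/existsP; apply: contraTT ltD => /existsPn led1; rewrite -leqNgt.
    apply: leq_trans (leq_addl _ _); rewrite -[X in (_ <= X)%N]card_ord -sum1_card.
    by apply: leq_sum => i _; have := led1 i; rewrite -leqNgt.
  set d' := fun i => (d i - (i == i0))%N.
  have eq_sum : (\sum_(i < m) d i = (\sum_(i < m) d' i).+1)%N.
    rewrite (bigD1 i0) //= [in RHS](bigD1 i0) //= /d' eqxx subn1 -addSn prednK //.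
    by congr addn; apply: eq_bigr => i /negbTE ->; rewrite subn0.
  have d'0 i : (0 < d' i)%N by rewrite /d'; have := d0 i; case: eqP => [->|_]; lia.
  apply: (inj_mulS_incr di0); rewrite -/d'.
    by apply: IHs; [lia | split=> //; lia].
  by move=> D' eD; apply: IHD => //; split=> //; lia.
move=> c van; have lt0t : (t.+1%:R != 0 :> F).
  by rewrite -(dvdn_pcharf charp) gtnNdvd //; lia.
have sumE : (\sum_(i < m) d i)%:R - m%:R - D0%:R *+ 2 - t.+1%:R + 1 = 1 :> F.
  rewrite -eqD !natrD -addnn natrD.
  by ring.
(* By lower_iter the product of this function by s^t is lower d (s^(t+1) c),
   because the coefficient there is t+1 times 1 in the extremal case. *)
pose w mu := mulS (lower d c) mu + t.+1%:R * c mu.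
have van_w : vanish d D0 w.
  apply: IHt; first by split=> //; lia.
  move=> mu bmu dmu; rewrite iter_mulS_lin -iterSr.
  have := @lower_vanish d (D0 + t) _ _ mu bmu dmu.
  move/(_ (iter t.+1 mulS c)); rewrite -addnS => /(_ van).
  by rewrite (@lower_iter _ _ _ _ D0) ?sumE ?mulr1 //; lia.
(* L c has degree D0 - 1 and S^(t+2) kills it, so the induction on the degree applies. *)
have van_Fw : vanish d D0 (mulS (lower d c)).
  move=> mu bmu dmu; rewrite /mulS big1 // => i _; rewrite /mulX.
  case: ifP => // /negbT; rewrite -lt0n => mui.
  have dmui := mdeg_subU mui.
  have inj : inj_mulS F d t.+2 (mdeg (mu - U_(i))%MM).
    by apply: IHD; [rewrite dmui dmu | split=> //; lia].
  apply: inj => //; last exact: box_sub.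
  move=> nu bnu dnu; rewrite iterSr.
  have dnuE : mdeg nu = (D0 + t.+1)%N by lia.
  have := vanish_iter (t := t.+1) van_w bnu dnuE.
  by rewrite iter_mulS_lin van // mulr0 addr0.
move=> mu bmu dmu; have := van_w mu bmu dmu; rewrite /w van_Fw // add0r.
by move/eqP; rewrite mulf_eq0 (negbTE lt0t) => /eqP.
Qed.

End Lowering.

(** * Powers of the sum of the variables in characteristic p *)

Lemma exprD_pchar (A : comNzRingType) p e (x y : A) : p \in [pchar A] ->
  (x + y) ^+ (p ^ e) = x ^+ (p ^ e) + y ^+ (p ^ e).
Proof.
move=> charp; elim: e => [|e IHe]; first by rewrite !expr1.
by rewrite expnSr !exprM IHe -!(pFrobenius_autE charp) rmorphD.
Qed.

Lemma sum_expr_pchar (A : comNzRingType) p e (I : Type) (r : seq I) (f : I -> A) :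
  p \in [pchar A] ->
  (\sum_(i <- r) f i) ^+ (p ^ e) = \sum_(i <- r) f i ^+ (p ^ e).
Proof.
move=> charp; apply: (big_morph (fun x => x ^+ (p ^ e))).
  by move=> x y; apply: exprD_pchar.
by rewrite expr0n expn_eq0 -leqn0 leqNgt prime_gt0 ?(pcharf_prime charp).
Qed.

Lemma pchar_mpoly (R : comNzRingType) m p :
  p \in [pchar R] -> p \in [pchar {mpoly R[m]}].
Proof. exact: (rmorph_pchar (mpolyC m (R := R))). Qed.

Section Frobenius.
Variables (R : comNzRingType) (m : nat).
Implicit Types (c : 'X_{1..m} -> R) (u : {mpoly R[m]}) (mu nu : 'X_{1..m}).

Lemma mcoeffXM nu u mu :
  ('X_[nu] * u)@_mu = if (nu <= mu)%MM then u@_(mu - nu)%MM else 0.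
Proof.
rewrite mulrC; case: ifP => [le|nle]; first by rewrite -{1}(submK le) addmC mcoeffMX.
rewrite memN_msupp_eq0 // (perm_mem (msuppMX _ _)); apply/mapP => -[x _ emu].
by rewrite emu lem_addr in nle.
Qed.

Lemma mcoeffXM1 i u mu : ('X_i * u)@_mu = mulX i (fun nu => u@_nu) mu.
Proof. by rewrite mcoeffXM lep1mP /mulX; case: eqP. Qed.

Lemma mcoeffSM u mu : ((\sum_(i < m) 'X_i) * u)@_mu = mulS (fun nu => u@_nu) mu.
Proof.
by rewrite mulr_suml raddf_sum; apply: eq_bigr => i _; apply: mcoeffXM1.
Qed.

(** This brings the iterates of [mulS] into the ring of polynomials, where the Frobenius
    morphism is available. *)
Lemma mcoeffSnM t u mu :
  ((\sum_(i < m) 'X_i) ^+ t * u)@_mu = iter t mulS (fun nu => u@_nu) mu.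
Proof.
elim: t mu => [|t IHt] mu; first by rewrite mul1r.
by rewrite exprS -mulrA mcoeffSM; apply: eq_mulS.
Qed.

Lemma iter_mulS_local N t c c' :
  (forall nu, (mdeg nu <= N)%N -> c nu = c' nu) ->
  forall nu, (mdeg nu <= N)%N -> iter t mulS c nu = iter t mulS c' nu.
Proof.
move=> ec; elim: t => //= t IHt nu lenu; apply: eq_bigr => i _; rewrite /mulX.
by case: ifP => // _; apply: IHt; apply: leq_trans lenu; apply: mdegB.
Qed.

Lemma iter_mulS_pchar p e c mu : p \in [pchar R] ->
  iter (p ^ e) mulS c mu = \sum_(i < m)
    if (p ^ e <= mu i)%N then c (mu - U_(i) *+ (p ^ e))%MM else 0.
Proof.
move=> charp; pose N := (mdeg mu).+1.
pose u := \sum_(nu : 'X_{1..m < N}) (c nu *: 'X_[R, nu]).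
have uE nu : (mdeg nu <= mdeg mu)%N -> u@_nu = c nu.
  by move=> lenu; apply: mcoeff_mpoly.
rewrite -(iter_mulS_local _ uE) // -mcoeffSnM.
rewrite sum_expr_pchar ?pchar_mpoly // mulr_suml raddf_sum; apply: eq_bigr => i _.
rewrite /= mpolyXn mcoeffXM; have -> : (U_(i) *+ p ^ e <= mu)%MM = (p ^ e <= mu i)%N.
  apply/mnm_lepP/idP => [/(_ i)|lemu j]; first by rewrite mulmnE mnm1E eqxx mul1n.
  by rewrite mulmnE mnm1E; case: eqP => [<-|_]; rewrite ?mul1n.
by case: ifP => // _; apply/uE/mdegB.
Qed.

End Frobenius.

(** * Corner values and their comparison between scales *)

(** With d_i = x this is q K + 2 max(x - q K, 0), so that the value V(K) attached to an
    integer vector K is half of 2 q - q m plus the sum of the costs. *)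
Definition cost q x K : nat := (q * K + 2 * (x - q * K))%N.

(** D is less than the value V(K) of every vector K whose sum has the parity of m;
    2 V(K) is written with all the negative terms moved to the left. *)
Definition below_corners q m (d : 'I_m -> nat) D : Prop :=
  forall K : 'I_m -> nat, odd (\sum_(i < m) K i) = odd m ->
  (2 * D + q * m < 2 * q + \sum_(i < m) cost q (d i) (K i))%N.

Lemma odd_sum (I : finType) (f g : I -> nat) : (forall i, odd (f i) = odd (g i)) ->
  odd (\sum_i f i) = odd (\sum_i g i).
Proof.
move=> efg; elim/big_rec2: _ => // i a b _ eab.
by rewrite !oddD efg eab.
Qed.

Lemma cost_floor q a b : cost q (a * q + b) a = (a * q + 2 * b)%N.
Proof. by rewrite /cost mulnC addKn. Qed.

Lemma cost_ceil q a b : (b <= q)%N -> cost q (a * q + b) a.+1 = (a * q + q)%N.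
Proof.
move=> lebq; rewrite /cost mulnS [(q * a)%N]mulnC; lia.
Qed.

(** The two multiples of p = 2 h + 1 around l: the nearest one is at distance u.2, and
    moving to the other one changes both the parity and the distance to p - u.2. *)
Lemma cost_nearest h l : exists u : nat * nat * nat,
  [/\ (u.2 <= h)%N, cost h.*2.+1 l u.1.1 = (l + u.2)%N,
      cost h.*2.+1 l u.1.2 = (l + (h.*2.+1 - u.2))%N,
      odd u.1.1 = odd (l + u.2) & odd u.1.2 = ~~ odd u.1.1].
Proof.
set p := h.*2.+1; have op : odd p by rewrite /= odd_double.
have lE := divn_eq l p; have ltp : (l %% p < p)%N by rewrite ltn_mod.
have oddl : odd l = odd (l %/ p) (+) odd (l %% p) by rewrite {1}lE oddD oddM op andbT.
move: (l %/ p)%N (l %% p)%N lE ltp oddl => a b -> ltp oddl.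
have [le_bh|lt_hb] := leqP b h.
  exists ((a, a.+1), b); rewrite /= cost_floor cost_ceil; last by lia.
  split=> //; [by lia | by lia |].
  by rewrite oddD oddl -addbA addbb addbF.
exists ((a.+1, a), (p - b)%N); rewrite /= cost_floor cost_ceil; last by lia.
split; [by lia | by lia | by lia | | by rewrite negbK].
rewrite oddD oddl oddB; last by lia.
by rewrite op; case: (odd a); case: (odd b).
Qed.

(** Each vector of the right parity is at L^1 distance at most (p - 1) (m - 2) from p
    times such a vector.  Rounding every coordinate costs at most m (p - 1) / 2; if
    the parity is wrong, the coordinate with the largest error is rounded the other
    way.  For m = 4 the resulting bound is exceeded by one at most, and parity saves
    that one. *)
Lemma corner_approx h m (l : 'I_m -> nat) : (0 < h)%N -> (3 < m)%N ->
  odd (\sum_(i < m) l i) = odd m ->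
  exists K : 'I_m -> nat, odd (\sum_(i < m) K i) = odd m /\
  (\sum_(i < m) cost h.*2.+1 (l i) (K i) <= \sum_(i < m) l i + h.*2 * (m - 2))%N.
Proof.
move=> h0 m3 oddl; have [u uP] := fin_all_exists (fun i => cost_nearest h (l i)).
set p := h.*2.+1 in uP *; pose del i := (u i).2.
have le_del : (\sum_(i < m) del i <= m * h)%N.
  rewrite -[X in (_ <= X * _)%N]card_ord -sum_nat_const.
  by apply: leq_sum => i _; case: (uP i).
have odd_K0 : odd (\sum_(i < m) (u i).1.1) = odd m (+) odd (\sum_(i < m) del i).
  rewrite -oddl -oddD -big_split; apply: odd_sum => i /=.
  by case: (uP i).
have [odd_del|even_del] := boolP (odd (\sum_(i < m) del i)); last first.
  exists (fun i => (u i).1.1); split; first by rewrite odd_K0 (negbTE even_del) addbF.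
  have -> : (\sum_(i < m) cost p (l i) (u i).1.1 = \sum_(i < m) l i + \sum_(i < m) del i)%N.
    by rewrite -big_split; apply: eq_bigr => i _; case: (uP i).
  by rewrite leq_add2l; apply: leq_trans le_del _; nia.
have i0 : 'I_m by case: (m) m3 => // m' _; exact: ord0.
case: (@arg_maxnP _ i0 xpredT del isT) => i1 _ max_i1.
exists (fun i => if i == i1 then (u i).1.2 else (u i).1.1); split.
  rewrite (bigD1 i1) //= eqxx oddD; case: (uP i1) => _ _ _ _ ->.
  move: odd_K0; rewrite (bigD1 i1) //= oddD odd_del.
  under [in X in _ -> X]eq_bigr => i /negbTE -> do [].
  by case: (odd _); case: (odd m); case: (odd _).
rewrite (bigD1 i1) //= eqxx; under eq_bigr => i /negbTE -> do [].
have -> : (\sum_(i < m | i != i1) cost p (l i) (u i).1.1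
    = \sum_(i < m | i != i1) l i + \sum_(i < m | i != i1) del i)%N.
  by rewrite -big_split; apply: eq_bigr => i _; case: (uP i).
case: (uP i1) => le_h _ -> _ _; rewrite [in X in (_ <= X)%N](bigD1 i1) //=.
move: odd_del le_del; rewrite (bigD1 i1) //= oddD -/(del i1); rewrite -/(del i1) in le_h *.
have : (\sum_(i < m | i != i1) del i <= m.-1 * del i1)%N.
  apply: leq_trans (_ : \sum_(i < m | i != i1) del i1 <= _)%N.
    by apply: leq_sum => i _; apply: max_i1.
  by rewrite sum_nat_const cardC1 card_ord.
move: (\sum_(i < m | i != i1) del i)%N (del i1) (\sum_(i < m | i != i1) l i)%N (l i1) le_h.
rewrite /p => s t L lt; case: m m3 {l oddl u uP del odd_K0 i0 i1 max_i1} => // m m3.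
move=> le_th le_s odd_st le_st.
(* With all errors equal and m = 4 the sum of the errors would be even. *)
have key : (s + (p - t) <= h.*2 * (m.+1 - 2))%N.
  have [m4|m4] : m = 3 \/ (4 <= m)%N by lia.
    subst m; rewrite /p; have : (s + t <> 4 * h)%N by lia.
    by nia.
  by rewrite /p; nia.
by lia.
Qed.

(** * Cutting the coordinate axes into segments *)

Section Segments.
Local Open Scope nat_scope.
Variables (q k r : nat).
Hypotheses (q0 : (0 < q)%N) (ltr : (r < q)%N).

(** Each period of length q is cut into the segments [0, r) and [r, q), the first of which
    may be empty; the segments, including the empty ones, are numbered in increasing
    order. *)
Definition seg x : nat := (2 * (x %/ q) + (r <= x %% q)%N)%N.
Definition seg_base x : nat := (q * (x %/ q) + (if r <= x %% q then r else 0))%N.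
Definition seg_len x : nat := if (r <= x %% q)%N then (q - r)%N else r.

Lemma mem_seg x : (seg_base x <= x < seg_base x + seg_len x)%N.
Proof.
rewrite /seg_base /seg_len; have := divn_eq x q; have := ltn_pmod x q0.
by case: (leqP r); move: (x %/ q)%N (x %% q)%N => a b; lia.
Qed.

Lemma eq_seg x y : (seg_base x <= y < seg_base x + seg_len x)%N ->
  y %/ q = x %/ q /\ seg y = seg x.
Proof.
rewrite /seg_base /seg_len /seg => mem_y; have ltm := ltn_pmod x q0.
have divy : (y %/ q = x %/ q)%N.
  apply/eqP; rewrite eqn_leq -ltnS ltn_divLR // leq_divRL // mulSn mulnC.
  by move: mem_y; case: (leqP r); lia.
split=> //; rewrite divy; congr (_ + nat_of_bool _)%N.
have : (y %% q = y - x %/ q * q)%N by rewrite {2}(divn_eq y q) divy addKn.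
by move=> ->; move: mem_y; case: (leqP r); lia.
Qed.

Lemma seg_pred x y : (y.+1 = seg_base x)%N ->
  (y %/ q <= x %/ q)%N /\ (seg y < seg x)%N.
Proof.
move=> ey; have ltm := ltn_pmod x q0; have := mem_seg x; rewrite -ey => mem_x.
have ley : (y <= x)%N by lia.
have lediv := leq_div2r q ley; split=> //; rewrite /seg.
move: lediv; rewrite leq_eqVlt => /orP[/eqP ediv|]; last by lia.
have : (y %% q = y - x %/ q * q)%N by rewrite {2}(divn_eq y q) ediv addKn.
move: ey ; rewrite /seg_base ediv => ey emod.
have := leq_trunc_div y q; rewrite ediv => letr.
by move: ey; case: (leqP r); rewrite emod; case: (leqP r); lia.
Qed.

Lemma seg_below x y : (x < k * q + r)%N ->
  (seg_base x <= y < seg_base x + seg_len x)%N -> (y < k * q + r)%N.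
Proof.
have ltm := ltn_pmod x q0; rewrite /seg_base /seg_len {1}(divn_eq x q).
have [lt_xk|le_kx] := ltnP (x %/ q) k.
  have := leq_mul2r q (x %/ q).+1 k; rewrite mulSn lt_xk orbT.
  by case: (leqP r); lia.
rewrite leq_eqVlt in le_kx; case/orP: le_kx => [/eqP ->|lt_kx].
  by case: (leqP r); lia.
have := leq_mul2r q k.+1 (x %/ q); rewrite mulSn lt_kx orbT.
by case: (leqP r); lia.
Qed.

(** A coordinate K' of the cell is matched with a coordinate K of the box: on [0, r) the
    values 1 and 0 correspond to k + 1 and k, on [r, q) to k and k + 1.  Larger values of
    K' cost at least as much as the one among 0 and 1 of the same parity. *)
Lemma seg_cost x K' : exists K, odd K = odd (k + K' + seg x) /\
  (cost q (k * q + r) K + q * seg x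
     <= k * q + 2 * seg_base x + cost q (seg_len x) K')%N.
Proof.
have leqK : odd K' -> (q <= cost q (seg_len x) K')%N.
  case: K' => // K' _; rewrite /cost mulnS -addnA; exact: leq_addr.
have le2K : ~~ odd K' -> (2 * seg_len x <= cost q (seg_len x) K')%N.
  case: K' leqK => [|[|K']] // _ _; first by rewrite /cost muln0 add0n subn0.
  have le_len : (seg_len x <= q)%N by rewrite /seg_len; case: ifP; lia.
  by rewrite /cost mulnS mulnS; lia.
rewrite /seg /seg_base /seg_len in leqK le2K *.
have [oK|eK] := boolP (odd K').
  move: (leqK oK); case: (leqP r) => _ leK; [exists k | exists k.+1]; split.
  - by rewrite !oddD oK /=; case: (odd k); case: (odd _).
  - by rewrite cost_floor; lia.
  - by rewrite !oddD oK /=; case: (odd k); case: (odd _).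
  - by rewrite cost_ceil; lia.
move: (le2K eK); case: (leqP r) => _ leK; [exists k.+1 | exists k]; split.
- by rewrite !oddD (negbTE eK) /=; case: (odd k); case: (odd _).
- by rewrite cost_ceil; lia.
- by rewrite !oddD (negbTE eK) /=; case: (odd k); case: (odd _).
- by rewrite cost_floor; lia.
Qed.

End Segments.

(** Summing [seg_cost] turns the bounds by the corner values of the box into bounds by the
    corner values of the cell containing x, once the base of the cell is removed from the
    degree; the level of the cell measures the shift between the two families. *)
Lemma seg_corners q m (k r : 'I_m -> nat) D (x : 'I_m -> nat) N :
  (0 < q)%N -> (forall i, r i < q)%N ->
  below_corners q (fun i => k i * q + r i)%N D ->
  (D = \sum_(i < m) seg_base q (r i) (x i) + N)%N ->
  forall K' : 'I_m -> nat,
  odd (\sum_(i < m) K' i) = odd (m + \sum_(i < m) k i + \sum_(i < m) seg q (r i) (x i)) ->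
  (2 * N + q * (\sum_(i < m) seg q (r i) (x i)) + q * m < 2 * q +
     q * (\sum_(i < m) k i) + \sum_(i < m) cost q (seg_len q (r i) (x i)) (K' i))%N.
Proof.
move=> q0 ltr below eD K' oddK'.
have [K KP] := fin_all_exists (fun i => seg_cost (k i) q0 (ltr i) (x i) (K' i)).
have oddK : odd (\sum_(i < m) K i) = odd m.
  rewrite (odd_sum (fun i => proj1 (KP i))) 2!big_split /= !oddD oddK' !oddD.
  by case: (odd m); case: (odd (\sum_(i < m) k i)); case: (odd _).
have := below K oddK; rewrite {}eD.
have : (\sum_(i < m) cost q (k i * q + r i) (K i) + q * \sum_(i < m) seg q (r i) (x i)
   <= q * (\sum_(i < m) k i) + 2 * (\sum_(i < m) seg_base q (r i) (x i))
      + \sum_(i < m) cost q (seg_len q (r i) (x i)) (K' i))%N.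
  rewrite !big_distrr -!big_split; apply: leq_sum => i _ /=.
  by rewrite [(q * k i)%N]mulnC; case: (KP i).
by lia.
Qed.

Section Cells.
Variables (R : comNzRingType) (m : nat).
Implicit Types (c : 'X_{1..m} -> R) (mu nu : 'X_{1..m}).

(** If c vanishes at all monomials from which multiplication by a variable enters the
    cell, the restriction of c to the cell is killed by the sum of the variables. *)
Lemma cell_vanish c d D (base len : 'I_m -> nat) N mu :
  (forall i, base i <= mu i < base i + len i)%N ->
  (forall i x, base i <= x < base i + len i -> x < d i)%N ->
  mdeg mu = D -> (D = \sum_(i < m) base i + N)%N ->
  vanish d D.+1 (mulS c) ->
  (forall i nu, (nu i).+1 = base i ->
     (forall l, l != i -> (base l <= nu l < base l + len l)%N) ->
     mdeg nu = D -> c nu = 0) ->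
  inj_mulS R len 1 N -> c mu = 0.
Proof.
move=> mem_mu sub dmu eD van bdry inj.
pose B := [multinom base i | i < m].
have mdegB : (mdeg B = \sum_(i < m) base i)%N.
  by rewrite mdegE; apply: eq_bigr => i _; rewrite mnmE.
have leB : (B <= mu)%MM by apply/mnm_lepP => i; rewrite mnmE; case/andP: (mem_mu i).
rewrite -(submK leB); apply: (inj (fun nu => c (nu + B)%MM)); last 2 first.
- by move=> i; rewrite mnmBE mnmE; have := mem_mu i; lia.
- by have := congr1 mdeg (submK leB); rewrite mdegD dmu mdegB; lia.
move=> nu bnu dnu /=.
have memD i : (base i <= (nu + B)%MM i < base i + len i)%N.
  by rewrite mnmDE mnmE; have := bnu i; lia.
have dnuD : mdeg (nu + B)%MM = D.+1 by rewrite mdegD mdegB dnu; lia.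
rewrite -[RHS](van (nu + B)%MM) //; last by move=> i; apply/sub/memD.
apply: eq_bigr => i _; rewrite /mulX mnmDE mnmE.
have [nui|nui] := posnP (nu i); last first.
  have -> : (nu i + base i == 0)%N = false by lia.
  congr c; apply/mnmP => j; rewrite !(mnmDE, mnmBE, mnm1E).
  by case: eqP => [<-|]; lia.
rewrite nui /=; case: ifP => // /negbT basei.
have pos : (0 < (nu + B)%MM i)%N by rewrite mnmDE mnmE; lia.
apply/esym/(bdry i).
- by rewrite mnmBE mnmDE mnmE mnm1E eqxx nui; lia.
- move=> l neq_li; rewrite mnmBE mnm1E [i == l]eq_sym (negbTE neq_li) subn0.
  exact: memD.
- by apply/succn_inj; rewrite mdeg_subU.
Qed.

End Cells.

(** * Peeling off the base q digits of the exponents *)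

Lemma digit_below q k r a b : (b < q)%N -> (r < q)%N ->
  (a < k + (b < r))%N -> (a * q + b < k * q + r)%N.
Proof.
move=> ltb ltr; case: (ltnP b) => leb lta; last first.
  have ltak : (a < k)%N by lia.
  by have := leq_mul ltak (leqnn q); rewrite mulSn; lia.
have leak : (a <= k)%N by lia.
by have := leq_mul leak (leqnn q); lia.
Qed.

Section Digits.
Variables (F : fieldType) (m p e : nat) (k r : 'I_m -> nat) (D : nat).
Variable c : 'X_{1..m} -> F.
Let q := (p ^ e)%N.
Let d i := (k i * q + r i)%N.
Hypotheses (charp : p \in [pchar F]) (ltr : forall i, (r i < q)%N).
Hypothesis van : vanish d D.+1 (mulS c).

Let q0 : (0 < q)%N.
Proof. by rewrite expn_gt0 prime_gt0 // (pcharf_prime charp). Qed.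

Let quot (mu : 'X_{1..m}) := (\sum_(i < m) mu i %/ q)%N.
Let level (mu : 'X_{1..m}) := (\sum_(i < m) seg q (r i) (mu i))%N.

Let mdeg_quot mu : mdeg mu = (q * quot mu + \sum_(i < m) mu i %% q)%N.
Proof.
rewrite mdegE big_distrr -big_split; apply: eq_bigr => i _ /=.
by rewrite mulnC -divn_eq.
Qed.

(** For fixed remainders b modulo q, the coefficients c (q nu + b) form an element of a
    quotient with exponents k i or k i + 1, killed by the sum of the variables because
    S^q is the sum of the X_i^q.  The assumption on the level says that it lies below
    the middle degree, where [inj_mulS_lefschetz] applies with t = 1. *)
Lemma vanish_low_level mu : box d mu -> mdeg mu = D -> ((quot mu).+1 < p)%N ->
  (level mu < \sum_(i < m) k i)%N -> c mu = 0.
Proof.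
move=> bmu dmu ltp ltk.
pose a := [multinom (mu i %/ q)%N | i < m]; pose b := [multinom (mu i %% q)%N | i < m].
pose kb i := (k i + (b i < r i)%N)%N.
pose lift (nu : 'X_{1..m}) := (nu *+ q + b)%MM.
have muE : lift a = mu.
  by apply/mnmP => i; rewrite mnmDE mulmnE !mnmE -divn_eq.
have ltb i : (b i < q)%N by rewrite mnmE ltn_pmod.
have box_lift nu : box kb nu -> box d (lift nu).
  by move=> bnu i; rewrite mnmDE mulmnE; apply: digit_below.
have mdeg_lift nu : mdeg (lift nu) = (q * mdeg nu + mdeg b)%N.
  by rewrite mdegD mdegMn mulnC.
have mdega : mdeg a = quot mu by rewrite mdegE; apply: eq_bigr => i _; rewrite mnmE.
have ba : box kb a.
  move=> i; have := bmu i; rewrite /d -{1}muE mnmDE mulmnE /kb.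
  have := ltb i; have := ltr i; move: (a i) (b i) => x y lt_r lt_y lt_d.
  rewrite ltnNge; apply/negP => le_x.
  have := leq_mul le_x (leqnn q); rewrite mulnDl.
  by move: lt_d; case: (ltnP y (r i)) => cmp_yr; rewrite ?mul1n ?mul0n; lia.
have sum_kb : (\sum_(i < m) kb i + level mu = \sum_(i < m) k i + m + 2 * quot mu)%N.
  have -> : (\sum_(i < m) k i + m + 2 * quot mu
      = \sum_(i < m) (k i + 1 + 2 * (mu i %/ q)))%N.
    by rewrite 2!big_split /= sum_nat_const card_ord muln1 -big_distrr.
  rewrite -big_split; apply: eq_bigr => i _ /=; rewrite /kb /seg mnmE.
  by case: (leqP (r i)); lia.
have inj : inj_mulS F kb 1 (mdeg a).
  apply: inj_mulS_lefschetz charp _ _ _; last by rewrite mdega -muln2; lia.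
    by move=> i; apply: leq_ltn_trans (ba i).
  by rewrite mdega addn1.
rewrite -muE; apply: (inj (fun nu => c (lift nu))) => // nu bnu dnu /=.
have -> : mulS (fun nu => c (lift nu)) nu = iter q mulS c (lift nu).
  rewrite iter_mulS_pchar //; apply: eq_bigr => i _; rewrite /mulX -/q.
  rewrite mnmDE mulmnE; case: posnP => [->|nui].
    by rewrite mul0n add0n leqNgt ltb.
  have -> : (q <= nu i * q + b i)%N.
    by apply: leq_trans (leq_addr _ _); apply: leq_pmull.
  congr c; apply/mnmP => j; rewrite !(mnmBE, mnmDE, mulmnE, mnm1E).
  case: eqP => [<-|_]; rewrite ?mul1n ?mul0n ?subn0 // mulnBl mul1n addnBAC //.
  exact: leq_pmull.
rewrite -(prednK q0) iterSr; apply: (@vanish_iter _ _ d D.+1) => //.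
  exact: box_lift.
rewrite mdeg_lift dnu addn1 mulnS -addnA -{}dmu -[in RHS]muE mdeg_lift.
by lia.
Qed.

Let mem_base mu : D = mdeg mu ->
  exists N, D = (\sum_(i < m) seg_base q (r i) (mu i) + N)%N.
Proof.
move=> ->; exists (mdeg mu - \sum_(i < m) seg_base q (r i) (mu i))%N.
rewrite subnKC // mdegE; apply: leq_sum => i _.
by case/andP: (mem_seg q0 (ltr i) (mu i)).
Qed.

(** All the neighbours through which multiplication enters a cell have smaller level, and
    no larger quotient modulo q. *)
Let vanish_step s N mu :
  (forall nu, box d nu -> mdeg nu = D -> ((quot nu).+1 < p)%N ->
     (level nu < s)%N -> c nu = 0) ->
  box d mu -> mdeg mu = D -> ((quot mu).+1 < p)%N -> level mu = s ->
  D = (\sum_(i < m) seg_base q (r i) (mu i) + N)%N ->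
  inj_mulS F (fun i => seg_len q (r i) (mu i)) 1 N -> c mu = 0.
Proof.
move=> low bmu dmu ltp lmu eD; apply: (cell_vanish (d := d)) eD van _ => //.
- by move=> i; apply: mem_seg.
- by move=> i x; apply: seg_below.
move=> i nu nui mem_nu dnu.
have [le_i lt_i] := seg_pred q0 (ltr i) nui.
have eq_l l : l != i -> (nu l %/ q = mu l %/ q)%N /\
    seg q (r l) (nu l) = seg q (r l) (mu l).
  by move=> /mem_nu; apply: eq_seg.
apply: low => //.
- move=> l; have [->|/mem_nu] := eqVneq l i; last exact: seg_below.
  by have := bmu i; have := mem_seg q0 (ltr i) (mu i); rewrite -nui; lia.
- apply: leq_ltn_trans ltp; rewrite ltnS; apply: leq_sum => l _.
  by have [->//|/eq_l[->]] := eqVneq l i.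
rewrite -lmu /level (bigD1 i) //= [X in (_ < X)%N](bigD1 i) //= -addSn leq_add //.
by apply: leq_sum => l /eq_l[_ ->].
Qed.

Hypotheses (ltD : (D.+1 < p * q)%N) (below : below_corners q d D.+1).
Hypothesis balanced : (2 < p)%N \/ (p <= \sum_(i < m) k i)%N.
Hypothesis inj_cells : forall mu N, box d mu -> mdeg mu = D ->
  D = (\sum_(i < m) seg_base q (r i) (mu i) + N)%N -> ((quot mu).+1 < p)%N ->
  level mu = (\sum_(i < m) k i)%N ->
  inj_mulS F (fun i => seg_len q (r i) (mu i)) 1 N.

Let cost_one l : (l <= q)%N -> cost q l 1 = q.
Proof. by move=> lel; rewrite /cost; lia. Qed.

Let len_le i x : (seg_len q (r i) x <= q)%N.
Proof. by rewrite /seg_len; have := ltr i; case: ifP; lia. Qed.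

(** This is [seg_corners] for K' constant equal to 1. *)
Let level_even mu N : mdeg mu = D -> 
  D = (\sum_(i < m) seg_base q (r i) (mu i) + N)%N ->
  odd (level mu) = odd (\sum_(i < m) k i) -> (level mu <= \sum_(i < m) k i)%N.
Proof.
move=> dmu eD parity.
have eD1 : D.+1 = (\sum_(i < m) seg_base q (r i) (mu i) + N.+1)%N by lia.
have := seg_corners q0 ltr below eD1 (K' := fun=> 1%N).
rewrite -/(level mu) sum_nat_const card_ord muln1 !oddD parity.
case/(_ _)/Wrap => [|]; first by case: (odd m); case: (odd _).
have -> : (\sum_(i < m) cost q (seg_len q (r i) (mu i)) 1 = m * q)%N.
  rewrite -[X in (X * q)%N]card_ord -sum_nat_const.
  by apply: eq_bigr => i _; apply: cost_one.
move=> lt_q; have : (q * level mu < q * (\sum_(i < m) k i + 2))%N by lia.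
by rewrite ltn_pmul2l //; move: parity; lia.
Qed.

(** This is [seg_corners] for K' equal to 1 except at j, where it is 0. *)
Let level_odd mu N (j : 'I_m) : mdeg mu = D ->
  D = (\sum_(i < m) seg_base q (r i) (mu i) + N)%N ->
  odd (level mu) != odd (\sum_(i < m) k i) ->
  (level mu <= (\sum_(i < m) k i).+1)%N /\
  (level mu = (\sum_(i < m) k i).+1 -> (N.+1 < seg_len q (r j) (mu j))%N).
Proof.
move=> dmu eD parity.
have eD1 : D.+1 = (\sum_(i < m) seg_base q (r i) (mu i) + N.+1)%N by lia.
have m0 : (0 < m)%N by case: (m) j => // -[].
have := seg_corners q0 ltr below eD1 (K' := fun i => (i != j)%N).
rewrite -/(level mu).
have -> : (\sum_(i < m) (i != j) = m.-1)%N.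
  rewrite (bigD1 j) //= eqxx add0n; under eq_bigr => i -> do [].
  by rewrite sum1_card cardC1 card_ord.
have -> : (\sum_(i < m) cost q (seg_len q (r i) (mu i)) (i != j)
    = 2 * seg_len q (r j) (mu j) + m.-1 * q)%N.
  rewrite (bigD1 j) //= eqxx /cost muln0 subn0 add0n; congr addn.
  rewrite -[X in X.-1](card_ord m) -(cardC1 j) -sum_nat_const.
  by apply: eq_bigr => i ->; apply: cost_one.
case/(_ _)/Wrap => [|].
  move: parity; rewrite !oddD (_ : odd m = ~~ odd m.-1); last by case: (m) m0.
  by case: (odd m.-1); case: (odd (level mu)); case: (odd _).
have -> : (q * m = q + q * m.-1)%N by rewrite -mulnS prednK.
move=> lt_q.
have lt_q1 : (2 * N.+1 + q * level mu
    < q * (\sum_(i < m) k i).+1 + 2 * seg_len q (r j) (mu j))%N by lia.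
split=> [|elev]; last by move: lt_q1; rewrite elev; lia.
have : (q * level mu < q * (\sum_(i < m) k i + 3))%N.
  by have := len_le j (mu j); lia.
by rewrite ltn_pmul2l //; move: parity; lia.
Qed.

(** Levels up to sum_i k i + 1 are treated one after the other, as long as the quotient
    has degree at most p - 2.  Once these are known to vanish, quotients of degree p - 1
    are treated with the cells cut at the multiples of q only.  Such a cell has a side of
    full length q: otherwise sum_i k i would be at most p - 1 and the level at least
    2 (p - 1), against [balanced] and the bound on the level. *)
Lemma vanish_digits (i0 : 'I_m) mu : box d mu -> mdeg mu = D -> c mu = 0.
Proof.
set s := (\sum_(i < m) k i)%N.
have low0 nu : box d nu -> mdeg nu = D -> ((quot nu).+1 < p)%N ->
    (level nu < s)%N -> c nu = 0 by apply: vanish_low_level.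
have low1 nu : box d nu -> mdeg nu = D -> ((quot nu).+1 < p)%N ->
    (level nu < s.+1)%N -> c nu = 0.
  move=> bnu dnu ltp; rewrite ltnS leq_eqVlt => /orP[/eqP lnu|]; last exact: low0.
  have [N eN] := mem_base (esym dnu).
  exact: (vanish_step low0 bnu dnu ltp lnu eN (inj_cells bnu dnu eN ltp lnu)).
move=> bmu dmu.
have low nu : box d nu -> mdeg nu = D -> ((quot nu).+1 < p)%N -> c nu = 0.
  move=> bnu dnu ltp; have [N eN] := mem_base (esym dnu).
  have [par|npar] := eqVneq (odd (level nu)) (odd s).
    by apply: low1; rewrite // ltnS (level_even dnu eN).
  have [le_s lt_len] := level_odd i0 dnu eN npar.
  move: le_s; rewrite leq_eqVlt => /orP[/eqP lnu|]; last exact: low1.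
  by apply: (vanish_step low1 bnu dnu ltp lnu eN); apply/(inj_mulS_free (j := i0))/lt_len.
(* It remains to treat quotients of degree exactly p - 1. *)
have [|ge_p] := ltnP (quot mu).+1 p; first exact: low.
have dmuE := mdeg_quot mu; have [N eN] := mem_base (esym dmu).
have lt_quot : (quot mu < p)%N.
  by rewrite -(ltn_pmul2l q0) [(q * p)%N]mulnC; lia.
have le_level : (level mu <= s.+1)%N.
  have [par|npar] := eqVneq (odd (level mu)) (odd s).
    by rewrite ltnW // ltnS (level_even dmu eN).
  by case: (level_odd i0 dmu eN npar).
have [j ltj] : exists j, (mu j %/ q < k j)%N.
  apply/existsP; apply: contraT => /existsPn no_j.
  have le_s : (s <= quot mu)%N.
    by apply: leq_sum => i _; have := no_j i; rewrite -leqNgt.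
  have : (2 * quot mu <= level mu)%N.
    by rewrite big_distrr; apply: leq_sum => i _; apply: leq_addr.
  by move: balanced; rewrite -/s; lia.
pose base i := (q * (mu i %/ q))%N.
pose len i := if (mu i %/ q < k i)%N then q else r i.
have len_q i : (len i <= q)%N by rewrite /len; case: ifP => // _; apply/ltnW.
have quot_base i x : (base i <= x < base i + len i)%N -> (x %/ q = mu i %/ q)%N.
  move=> /andP[le_x lt_x]; apply/eqP; rewrite eqn_leq -ltnS ltn_divLR // leq_divRL //.
  by rewrite mulSn mulnC -/(base i) le_x andbT; have := len_q i; lia.
have mem_mu i : (base i <= mu i < base i + len i)%N.
  have := bmu i; rewrite /d /base /len; have := ltn_pmod (mu i) q0.
  have := divn_eq (mu i) q; case: (ltnP (mu i %/ q)) => [_|le_k]; first by lia.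
  by have := leq_mul le_k (leqnn q); lia.
have base_d i x : (base i <= x < base i + len i)%N -> (x < d i)%N.
  move=> mem_x; have := mem_x; rewrite /base /len /d; case: (ltnP (mu i %/ q)) => [lt_k|le_k].
    by have := leq_mul lt_k (leqnn q); rewrite mulSn; lia.
  have := leq_mul le_k (leqnn q); have := bmu i; rewrite /d.
  have := divn_eq (mu i) q; set a := (mu i %/ q)%N => eq_mu lt_mu le_ka.
  have eq_a : a = k i.
    apply/eqP; rewrite eqn_leq le_k andbT -ltnS -(ltn_pmul2r q0) mulSn.
    by have := ltr i; lia.
  by rewrite eq_a; lia.
apply: (cell_vanish (N := (\sum_(i < m) mu i %% q)%N) mem_mu base_d dmu _ van).
- by rewrite -dmu dmuE big_distrr.
- move=> i nu nui mem_nu dnu; apply: low => //.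
    move=> l; have [->|/mem_nu] := eqVneq l i; last exact: base_d.
    by have := bmu i; have := mem_mu i; rewrite -nui; lia.
  apply: leq_ltn_trans lt_quot; rewrite /quot (bigD1 i) //=.
  rewrite [X in (_ < X)%N](bigD1 i) //= -addSn leq_add //.
    by rewrite ltn_divLR // mulnC -/(base i) -nui.
  by apply: leq_sum => l /mem_nu /quot_base ->.
apply: (inj_mulS_free (j := j)); rewrite /len ltj -(ltn_add2l (q * quot mu)).
rewrite addnS -dmuE dmu; apply: leq_trans ltD _.
by rewrite mulnC -mulnSr leq_pmul2l.
Qed.

End Digits.

(** * The lower bound in odd characteristic *)

(** If p = 2 h + 1 is odd, no corner value of scale q is less than the least one of scale
    p q.  This is [corner_approx] multiplied by q. *)
Lemma below_corners_refine h q m (d : 'I_m -> nat) D : (0 < h)%N -> (3 < m)%N ->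
  below_corners (h.*2.+1 * q) d D -> below_corners q d D.
Proof.
move=> h0 m3 below l oddl; have [K [oddK leK]] := corner_approx h0 m3 oddl.
have := below K oddK; set p := h.*2.+1 in leK *.
have le_cost i : (cost (p * q) (d i) (K i) + q * l i
    <= cost q (d i) (l i) + q * cost p (l i) (K i))%N.
  have -> : cost (p * q) (d i) (K i) = cost q (d i) (p * K i).
    by rewrite /cost mulnA [(q * p)%N]mulnC.
  rewrite /cost mulnDr; have -> : (q * (2 * (l i - p * K i))
      = 2 * (q * l i - q * (p * K i)))%N by rewrite mulnCA mulnBr.
  by move: (q * (p * K i))%N (q * l i)%N => A L; lia.
have : (\sum_(i < m) cost (p * q) (d i) (K i) + q * (\sum_(i < m) l i)
    <= \sum_(i < m) cost q (d i) (l i) + q * (\sum_(i < m) cost p (l i) (K i)))%N.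
  by rewrite !big_distrr -!big_split; apply: leq_sum => j _; apply: le_cost.
have := leq_mul (leqnn q) leK; rewrite mulnDr.
have -> : (p * q * m = q * m + 2 * (h * q * m))%N by rewrite /p; nia.
have -> : (p * q = q + 2 * (h * q))%N by rewrite /p; nia.
have : (q * (h.*2 * (m - 2)) + 4 * (h * q) = 2 * (h * q * m))%N by nia.
by lia.
Qed.

Lemma eq_below_corners q m (d d' : 'I_m -> nat) D : d =1 d' ->
  below_corners q d D -> below_corners q d' D.
Proof.
move=> eqd below K oddK; rewrite (eq_bigr (fun i => cost q (d i) (K i))).
  exact: below.
by move=> i _; rewrite eqd.
Qed.

Section LowerBound.
Variables (F : fieldType) (m p : nat).
Hypotheses (charp : p \in [pchar F]) (m3 : (3 < m)%N).
Implicit Types (d : 'I_m -> nat).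

Let i0 : 'I_m := Ordinal (ltnW (ltnW (ltnW m3))).

Let p0 : (1 < p)%N. Proof. by rewrite prime_gt1 // (pcharf_prime charp). Qed.

(** One step of the induction: the cells to be examined have sides at most q, the degree in
    them is less than q - 1, and it is below their own corner values. *)
Lemma inj_mulS_digits e d D :
  (2 < p)%N \/ (p <= \sum_(i < m) d i %/ p ^ e)%N ->
  (D.+1 < p * p ^ e)%N -> below_corners (p ^ e) d D.+1 ->
  (forall b N mu, (forall i, b i <= p ^ e)%N -> (N.+1 < p ^ e)%N ->
     below_corners (p ^ e) b N.+1 -> box d mu -> mdeg mu = D ->
     (forall i, b i = seg_len (p ^ e) (d i %% p ^ e) (mu i)) ->
     (D = \sum_(i < m) seg_base (p ^ e) (d i %% p ^ e) (mu i) + N)%N ->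
     ((\sum_(i < m) mu i %/ p ^ e).+1 < p)%N ->
     (\sum_(i < m) seg (p ^ e) (d i %% p ^ e) (mu i)
        = \sum_(i < m) d i %/ p ^ e)%N -> inj_mulS F b 1 N) ->
  inj_mulS F d 1 D.
Proof.
set q := (p ^ e)%N => bal ltD below inj.
have q0 : (0 < q)%N by rewrite expn_gt0 ltnW.
pose k i := (d i %/ q)%N; pose r i := (d i %% q)%N.
have eqd : (fun i => k i * q + r i)%N =1 d by move=> i; rewrite -divn_eq.
have ltr i : (r i < q)%N by rewrite ltn_pmod.
have below' := eq_below_corners (fun i => esym (eqd i)) below.
move=> c van mu bmu dmu.
have van' : vanish (fun i => k i * q + r i)%N D.+1 (mulS c).
  by move=> nu bnu; rewrite -addn1; apply: van => i; rewrite -eqd; apply: bnu.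
have bmu' : box (fun i => k i * q + r i)%N mu by move=> i; rewrite eqd; apply: bmu.
refine (vanish_digits charp ltr van' ltD below' bal _ i0 bmu' dmu).
move=> nu N bnu dnu; rewrite -/q /= => eN ltp lev.
have eN1 : (D.+1 = \sum_(i < m) seg_base q (r i) (nu i) + N.+1)%N.
  by rewrite addnS; congr S; apply: eN.
have len_le i : (seg_len q (r i) (nu i) <= q)%N.
  by rewrite /seg_len; have := ltr i; case: ifP; lia.
have below_len : below_corners q (fun i => seg_len q (r i) (nu i)) N.+1.
  move=> K oddK; have := seg_corners q0 ltr below' eN1 (K' := K).
  rewrite lev oddK !oddD -addbA addbb addbF => /(_ erefl).
  by move: (\sum_(i < m) k i)%N (\sum_(i < m) _)%N => s t; lia.
apply: inj lev => //; last by move=> i; rewrite -eqd; apply: bnu.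
have := below_len (fun=> 1%N); rewrite sum_nat_const card_ord muln1 => /(_ erefl).
have -> : (\sum_(i < m) cost q (seg_len q (r i) (nu i)) 1 = m * q)%N.
  rewrite -[X in (X * q)%N]card_ord -sum_nat_const; apply: eq_bigr => i _.
  by rewrite /cost; have := len_le i; lia.
by lia.
Qed.

(** The cells of scale p^(e+1) are boxes to which the statement at scale p^e applies: its
    condition D + 1 < p^(e+1) holds there, and [below_corners_refine] gives the other. *)
Lemma inj_mulS_odd e d D : odd p -> (D.+1 < p * p ^ e)%N ->
  below_corners (p ^ e) d D.+1 -> inj_mulS F d 1 D.
Proof.
move=> op; pose h := (p./2)%N; have ep : p = h.*2.+1.
  by rewrite -[LHS]odd_double_half op.
have h0 : (0 < h)%N by move: p0; rewrite ep; case: (h).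
have p2 : (2 < p)%N by rewrite ep; lia.
elim: e d D => [|e IHe] d D ltD below;
  apply: (inj_mulS_digits _ ltD below); first by left.
- by move=> b N mu _; rewrite expn0.
- by left.
move=> b N mu _ ltN belowb _ _ _ _ _ _; apply: IHe; first by rewrite -expnS.
by apply: (below_corners_refine (h := h)) => //; rewrite -ep -expnS.
Qed.

End LowerBound.

(** * Three exponents close to q *)

Lemma size_exp1DX (F : fieldType) n (g : {poly F}) : g != 0 ->
  size ((1 + 'X) ^+ n * g) = (n + size g)%N.
Proof.
move=> g0; have -> : (1 + 'X : {poly F}) = 'X - (- 1)%:P.
  by rewrite polyCN opprK addrC.
by rewrite size_mul ?expf_neq0 ?polyXsubC_eq0 // size_exp_XsubC addSn.
Qed.

Section ThreeVariables.
Variables (F : fieldType) (m p e : nat) (i0 i1 i2 : 'I_m).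
Hypotheses (charp : p \in [pchar F]) (neq01 : i0 != i1) (neq02 : i0 != i2)
  (neq12 : i1 != i2).
Let q := (p ^ e)%N.

(** Two variables, dehomogenised.  Multiply h = (1 + x)^b2 g by (1 + x)^(q - b2) to get
    g + x^q g.  The window of zero coefficients splits h as Q + x^b0 P with Q of small
    degree, and comparing the terms of degree less than b0 shows that
    (1 + x)^(q - b2) divides g, whose degree is too small. *)
Lemma poly_window b0 b1 b2 N (g : {poly F}) :
  (b0 <= q)%N -> (b1 <= q)%N -> (b2 <= q)%N -> (N.+1 < q)%N ->
  (N.+1 + q < b0 + b1 + b2)%N -> (size g + b2 <= N.+2)%N ->
  (forall x, (x < b0)%N -> (N.+1 < x + b1)%N -> ((1 + 'X) ^+ b2 * g)`_x = 0) ->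
  g = 0.
Proof.
move=> le0 le1 le2 ltN sumb size_g window; set h := _ * g in window.
have charP : p \in [pchar {poly F}] by rewrite pchar_poly.
have frob : (1 + 'X) ^+ (q - b2) * h = g + 'X^(q - b0) * g * 'X^b0.
  rewrite mulrA -exprD subnK // exprD_pchar // expr1n mulrDl mul1r.
  by congr (_ + _); rewrite mulrAC -exprD subnK.
pose Q := take_poly b0 h; pose P := drop_poly b0 h.
have size_h : (size h <= N.+2)%N.
  have [g0|g0] := eqVneq g 0; first by rewrite /h g0 mulr0 size_poly0.
  by rewrite size_exp1DX // addnC.
have size_Q : (size Q <= N.+2 - b1)%N.
  apply/leq_sizeP => x lex; rewrite coef_take_poly; case: ifP => // ltx.
  by apply: window; lia.
have size_Q1 : (size ((1 + 'X) ^+ (q - b2) * Q)%R <= b0)%N.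
  have [->|Q0] := eqVneq Q 0; first by rewrite mulr0 size_poly0.
  by rewrite size_exp1DX //; move: Q0; rewrite -size_poly_gt0; lia.
have size_g1 : (size g <= b0)%N by lia.
have gE : g = (1 + 'X) ^+ (q - b2) * Q.
  have := frob; rewrite -{1}(poly_take_drop b0 h) -/P -/Q mulrDr mulrA => eqg.
  have := congr1 (take_poly b0) eqg.
  by rewrite !take_polyDMXn.
apply/eqP/negP => /negP g0; have Q0 : Q != 0.
  by apply: contraNneq g0 => Q0; rewrite gE Q0 mulr0.
have : (0 < size Q)%N by rewrite size_poly_gt0.
have szE : size g = (q - b2 + size Q)%N by rewrite {1}gE size_exp1DX.
by move: size_g; rewrite szE; lia.
Qed.

Let mono x y z : 'X_{1..m} := (U_(i0) *+ x + U_(i1) *+ y + U_(i2) *+ z)%MM.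

Let monoE x y z i : mono x y z i =
  (if i == i0 then x else if i == i1 then y else if i == i2 then z else 0)%N.
Proof.
rewrite !mnmDE !mulmnE !mnm1E ![_ == i]eq_sym.
have [->|_] := eqVneq i i0.
  by rewrite (negbTE neq01) (negbTE neq02) mul1n !mul0n !addn0.
have [->|_] := eqVneq i i1; first by rewrite (negbTE neq12) mul1n !mul0n !addn0.
by case: eqP; rewrite ?mul1n !mul0n.
Qed.

Let mdeg_mono x y z : mdeg (mono x y z) = (x + y + z)%N.
Proof. by rewrite !mdegD !mdegMn !mdeg1 !mul1n. Qed.

Let mulS_mono (c : 'X_{1..m} -> F) x y z : mulS c (mono x y z) =
  (if x is x'.+1 then c (mono x' y z) else 0) +
  (if y is y'.+1 then c (mono x y' z) else 0) +
  (if z is z'.+1 then c (mono x y z') else 0).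
Proof.
rewrite /mulS (bigD1 i0) //= (bigD1 i1) 1?eq_sym //= (bigD1 i2) /=; last first.
  by rewrite ![i2 == _]eq_sym neq02 neq12.
rewrite big1 => [|i /andP[/andP[/negbTE ni0 /negbTE ni1] /negbTE ni2]]; last first.
  by rewrite /mulX monoE ni0 ni1 ni2.
rewrite addr0 addrA; congr (_ + _ + _); rewrite /mulX monoE !eqxx.
- case: x => //= x; congr c; apply/mnmP => i; rewrite mnmBE mnm1E !monoE eq_sym.
  by case: eqP => // _; rewrite ?subn1 ?subn0.
- rewrite [i1 == i0]eq_sym (negbTE neq01); case: y => //= y; congr c; apply/mnmP => i.
  rewrite mnmBE mnm1E !monoE [i1 == _]eq_sym.
  have [->|_] := eqVneq i i0; first by rewrite (negbTE neq01) subn0.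
  by case: eqP => // _; rewrite ?subn1 ?subn0.
- rewrite [i2 == i0]eq_sym (negbTE neq02) [i2 == i1]eq_sym (negbTE neq12).
  case: z => //= z; congr c; apply/mnmP => i; rewrite mnmBE mnm1E !monoE.
  rewrite [i2 == _]eq_sym.
  have [->|_] := eqVneq i i0; first by rewrite (negbTE neq02) subn0.
  have [->|_] := eqVneq i i1; first by rewrite (negbTE neq12) subn0.
  by case: eqP => // _; rewrite ?subn1 ?subn0.
Qed.

Let three b := forall i, i != i0 -> i != i1 -> i != i2 -> b i = 1%N.

(** Eliminating X_i2 by means of the relation S = 0 turns the coefficients of c with
    X_i2-exponent z0 - t into those of (- (1 + x))^t g, where g collects the coefficients
    with the largest exponent z0. *)
Let inj_three_unit b N : three b -> (0 < b i2)%N ->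
  (b i0 <= q)%N -> (b i1 <= q)%N -> (b i2 <= q)%N -> (N.+1 < q)%N ->
  (N.+1 + q < b i0 + b i1 + b i2)%N -> inj_mulS F b 1 N.
Proof.
move=> b1 b20 le0 le1 le2 ltN sumb.
have [ltNb|leNb] := ltnP N.+1 (b i2); first exact: (inj_mulS_free ltNb).
(* z0 is the largest exponent of X_i2, and j the degree left for the two other variables. *)
move=> c van; pose z0 := (b i2).-1; pose j := (N - z0)%N.
have box_mono x y z : (x < b i0)%N -> (y < b i1)%N -> (z < b i2)%N -> box b (mono x y z).
  move=> ltx lty ltz i; rewrite monoE.
  by do 3![case: eqVneq => [->//|?]]; rewrite b1.
pose g := \poly_(x < j.+1) c (mono x (j - x) z0).
pose G t := (- (1 + 'X)) ^+ t * g.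
have GS t x : (G t.+1)`_x = - ((G t)`_x + (if x is x'.+1 then (G t)`_x' else 0)).
  rewrite /G exprS -mulrA mulNr mulrDl mul1r coefN coefD coefXM.
  by case: x.
have size_G t : (size (G t) <= j.+1 + t)%N.
  elim: t => [|t IHt]; first by rewrite /G mul1r addn0 size_poly.
  apply/leq_sizeP => x lex; rewrite GS.
  rewrite (leq_sizeP _ _ IHt) ?add0r; last by lia.
  by case: x lex => [|x] lex; rewrite ?oppr0 // (leq_sizeP _ _ IHt) ?oppr0 //; lia.
have GE t x : (t <= z0.+1)%N -> (x <= j + t)%N -> (x < b i0)%N ->
    (j + t - x < b i1)%N ->
    (G t)`_x = if (t <= z0)%N then c (mono x (j + t - x) (z0 - t)) else 0.
  elim: t x => [|t IHt] x let_ lex ltx lty.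
    rewrite /G mul1r coef_poly subn0 addn0 ltnS.
    by rewrite addn0 in lex; rewrite lex.
  have : mulS c (mono x (j + t.+1 - x) (z0 - t)) = 0.
    apply: (van (mono x _ _)); first by apply: box_mono; lia.
    by rewrite mdeg_mono; lia.
  rewrite mulS_mono GS.
  have -> : (if (z0 - t)%N is z'.+1 then c (mono x (j + t.+1 - x) z') else 0)
      = if (t < z0)%N then c (mono x (j + t.+1 - x) (z0 - t.+1)) else 0.
    rewrite -subn_gt0; case ez: (z0 - t)%N => [|z'] //=.
    by have -> : (z0 - t.+1 = z')%N by lia.
  have -> : (G t)`_x = if (j + t.+1 - x)%N is y'.+1 then c (mono x y' (z0 - t)) else 0.
    case ey: (j + t.+1 - x)%N => [|y'].
      by rewrite (leq_sizeP _ _ (size_G t)) //; lia.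
    rewrite IHt; [|lia|lia|done|lia]; rewrite ifT; last by lia.
    by have -> : (j + t - x = y')%N by lia.
  have -> : (if x is x'.+1 then (G t)`_x' else 0)
      = if x is x'.+1 then c (mono x' (j + t.+1 - x) (z0 - t)) else 0.
    case: x lex ltx lty => // x' lex ltx lty.
    rewrite IHt; [|lia|lia|lia|lia]; rewrite ifT; last by lia.
    by have -> : (j + t.+1 - x'.+1 = j + t - x')%N by lia.
  by move/eqP; rewrite addr_eq0 addrC => /eqP ->; rewrite opprK.
(* The relation at X_i2-exponent 0 gives the window of zeros required by poly_window. *)
have g0 : g = 0.
  apply: (@poly_window (b i0) (b i1) (b i2) N) => //.
    by apply: leq_trans (leq_add (size_poly _ _) (leqnn _)) _; lia.
  move=> x ltx lty; have eb2 : b i2 = z0.+1 by rewrite prednK.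
  have : (G (b i2))`_x = 0.
    have [lex|ltNx] := leqP x N.+1; last first.
      by rewrite (leq_sizeP _ _ (size_G _)) //; lia.
    by rewrite GE; [rewrite ifF //; lia | lia | lia | lia | lia].
  rewrite /G -mulN1r exprMn_comm; last exact: commr_sym (commrN1 _).
  rewrite -mulrA -[(-1) ^+ _]signr_odd mulr_sign; case: ifP => // _.
  by rewrite coefN => /eqP; rewrite oppr_eq0 => /eqP.
move=> mu bmu dmu.
have muE : mu = mono (mu i0) (mu i1) (mu i2).
  apply/mnmP => i; rewrite monoE; do 3![case: eqVneq => [->//|?]].
  by have := bmu i; rewrite b1 //; case: (mu i).
have dmuE : (mu i0 + mu i1 + mu i2 = N)%N by rewrite -mdeg_mono -muE.
have lt0 := bmu i0; have lt1 := bmu i1; have lt2 := bmu i2.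
have := GE (z0 - mu i2)%N (mu i0).
rewrite /G g0 mulr0 coef0 ifT; last by lia.
have -> : (j + (z0 - mu i2) - mu i0 = mu i1)%N by lia.
have -> : (z0 - (z0 - mu i2) = mu i2)%N by lia.
by rewrite -muE => <- //; lia.
Qed.

(** The remaining exponents may be lowered to 1 by [inj_mulS_mono], which removes these
    variables. *)
Lemma inj_mulS_three b N : (forall i, 0 < b i)%N ->
  (b i0 <= q)%N -> (b i1 <= q)%N -> (b i2 <= q)%N -> (N.+1 < q)%N ->
  (N.+1 + q < b i0 + b i1 + b i2)%N -> inj_mulS F b 1 N.
Proof.
move=> b0 le0 le1 le2 ltN sumb.
pose b' i := if [|| i == i0, i == i1 | i == i2] then b i else 1%N.
have b'0 : b' i0 = b i0 by rewrite /b' eqxx.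
have b'1 : b' i1 = b i1 by rewrite /b' eqxx orbT.
have b'2 : b' i2 = b i2 by rewrite /b' eqxx !orbT.
apply: (@inj_mulS_mono _ _ b b') => [i|N' leN].
  by rewrite /b'; have := b0 i; case: ifP; rewrite ?leqnn ?andbT.
apply: inj_three_unit; rewrite ?b'0 ?b'1 ?b'2 //; try by lia.
by move=> i /negbTE n0 /negbTE n1 /negbTE n2; rewrite /b' n0 n1 n2.
Qed.

End ThreeVariables.

(** * The lower bound in every characteristic *)

(** In characteristic 2 all k i are 1 and only the cell of quotient 0 has to be examined;
    three of its sides suffice. *)
Lemma inj_mulS_below_corners (F : fieldType) m p e (k r : 'I_m -> nat) D :
  p \in [pchar F] -> (3 < m)%N -> (forall i, r i < p ^ e)%N ->
  (forall i, 0 < k i < p)%N -> (D.+1 < p * p ^ e)%N ->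
  below_corners (p ^ e) (fun i => k i * p ^ e + r i)%N D.+1 ->
  inj_mulS F (fun i => k i * p ^ e + r i)%N 1 D.
Proof.
set q := (p ^ e)%N => charp m3 ltr ltk ltD below.
case: (even_prime (pcharf_prime charp)) => [p2|op]; last first.
  exact: (inj_mulS_odd charp m3 op ltD below).
have q0 : (0 < q)%N by rewrite expn_gt0 p2.
have k1 i : k i = 1%N by have := ltk i; rewrite p2; case: (k i) => [|[|]].
have divE i : ((k i * q + r i) %/ q = 1)%N by rewrite divnMDl // divn_small ?addn0.
have modE i : ((k i * q + r i) %% q = r i)%N by rewrite modnMDl modn_small.
have sum_div : (\sum_(i < m) (k i * q + r i) %/ q = m)%N.
  under eq_bigr => i _ do rewrite divE.
  by rewrite sum1_card card_ord.
apply: (inj_mulS_digits charp m3 _ ltD below); rewrite -/q ?sum_div.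
  by right; rewrite p2; apply: leq_trans m3.
move=> b N mu _ ltN _ bmu dmu bE eD.
rewrite p2 ltnS ltnS leqn0 sum_nat_eq0 => /forallP /= mu0.
have {}mu0 i : (mu i %/ q = 0)%N by apply/eqP.
move=> sum_seg.
have segE i : (r i <= mu i %% q)%N.
  have le1 j : (seg q ((k j * q + r j) %% q) (mu j) <= 1)%N.
    by rewrite /seg mu0 muln0 add0n leq_b1.
  apply: contra_eqT sum_seg => nle; rewrite neq_ltn; apply/orP; left.
  rewrite (bigD1 i) //= /seg mu0 modE (negbTE nle) muln0 add0n.
  apply: leq_ltn_trans (_ : \sum_(j < m | j != i) 1 < m)%N; last first.
    by rewrite sum1_card cardC1 card_ord ltn_predL; apply: leq_trans m3.
  by apply: leq_sum => j _; apply: le1.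
have {}bE i : b i = (q - r i)%N by rewrite bE /seg_len modE segE.
have {}eD : (D = \sum_(i < m) r i + N)%N.
  rewrite eD; congr addn; apply: eq_bigr => i _.
  by rewrite /seg_base modE segE mu0 muln0.
pose i0 : 'I_m := Ordinal (ltnW (ltnW (ltnW m3))).
pose i1 : 'I_m := Ordinal (ltnW (ltnW m3)); pose i2 : 'I_m := Ordinal (ltnW m3).
have sum3 : (r i0 + r i1 + r i2 <= \sum_(i < m) r i)%N.
  by rewrite (bigD1 i0) //= (bigD1 i1) //= (bigD1 i2) //= !addnA leq_addr.
have := ltr i0; have := ltr i1; have := ltr i2 => lt2 lt1 lt0.
apply: (@inj_mulS_three _ _ p e i0 i1 i2) => //; rewrite -?/q ?bE ?leq_subr //.
  by move=> i; rewrite bE subn_gt0.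
by move: ltD; rewrite p2 eD; lia.
Qed.

(** * Elements killed by the sum of the variables *)

Section Existence.
Variables (F : fieldType) (m p : nat).
Hypothesis charp : p \in [pchar F].
Implicit Types (d w : 'I_m -> nat) (mu nu : 'X_{1..m}).

Lemma box_degree d N : (forall i, 0 < d i)%N -> (N + m <= \sum_(i < m) d i)%N ->
  exists mu, box d mu /\ mdeg mu = N.
Proof.
move=> d0; elim: N => [|N IHN] leN.
  by exists 0%MM; split=> [i|]; rewrite ?mdeg0 // mnm0E.
have [mu [bmu dmu]] := IHN (ltnW leN).
have [i lti] : exists i, (mu i + 1 < d i)%N.
  apply/existsP; apply: contraTT leN => /existsPn no; rewrite -ltnNge addSn ltnS.
  have -> : (N + m = \sum_(i < m) (mu i + 1))%N.
    by rewrite big_split /= -mdegE dmu sum1_card card_ord.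
  by apply: leq_sum => i _; have := no i; rewrite -leqNgt.
exists (mu + U_(i))%MM; split; last by rewrite mdegD mdeg1 dmu addn1.
by move=> j; rewrite mnmDE mnm1E; case: eqP => [<-|_] //; rewrite addn0.
Qed.

Lemma natr_fact_neq0 n : (n < p)%N -> n`!%:R != 0 :> F.
Proof.
elim: n => [|n IHn] ltn; first by rewrite oner_eq0.
rewrite factS natrM mulf_neq0 ?IHn 1?ltnW //.
by rewrite -(dvdn_pcharf charp) gtnNdvd.
Qed.

(** The witness is S^(p-1) divided by (p-1)!: the product by S is a multiple of p. *)
Lemma not_inj_mulS_pchar d : (forall i, 0 < d i <= p)%N ->
  (p.-1 + m <= \sum_(i < m) d i)%N -> ~ inj_mulS F d 1 p.-1.
Proof.
move=> dp led inj; have p0 : (0 < p)%N by rewrite prime_gt0 ?(pcharf_prime charp).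
pose c mu : F := (\prod_(i < m) (mu i)`!%:R)^-1.
have [mu [bmu dmu]] : exists mu, box d mu /\ mdeg mu = p.-1.
  by apply: box_degree led => i; case/andP: (dp i).
have ltp nu i : box d nu -> (nu i < p)%N.
  by move=> bnu; apply: leq_trans (bnu i) _; case/andP: (dp i).
have : c mu = 0; last first.
  apply/eqP; rewrite invr_eq0; apply/prodf_neq0 => i _.
  exact/natr_fact_neq0/ltp.
apply: (inj c) => // nu bnu; rewrite addn1 prednK // => dnu.
have cE i : mulX i c nu = (nu i)%:R * c nu.
  rewrite /mulX; case: posnP => [->|nui]; first by rewrite mul0r.
  rewrite /c (bigD1 i) //= [in RHS](bigD1 i) //= mnmBE mnm1E eqxx subn1.
  rewrite -[in RHS](prednK nui) factS natrM prednK //.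
  under eq_bigr => l nli do rewrite mnmBE mnm1E eq_sym (negbTE nli) subn0.
  rewrite -mulrA [in RHS]invfM mulrA mulfV ?mul1r //.
  by rewrite -(dvdn_pcharf charp) gtnNdvd ?ltp.
rewrite /= /mulS (eq_bigr _ (fun i _ => cE i)) -mulr_suml -natr_sum -mdegE dnu.
by rewrite (pcharf0 charp) mul0r.
Qed.

Definition incidence (E : seq ('I_m * 'I_m)) i : nat :=
  \sum_(e <- E) ((e.1 == i) + (e.2 == i))%N.

(** Join the two vertices with the largest remaining capacities.  Both conditions survive:
    if a third vertex violated the second one afterwards, its capacity, and hence the two
    larger ones, would be at least the number of edges still required, which leaves
    enough capacity away from this vertex. *)
Lemma multigraph w h : (2 * h <= \sum_(i < m) w i)%N ->
  (forall i, h + w i <= \sum_(i < m) w i)%N ->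
  exists E : seq ('I_m * 'I_m), [/\ size E = h, all (fun e => e.1 != e.2) E
    & forall i, (incidence E i <= w i)%N].
Proof.
elim: h w => [|h IHh] w le2h leh.
  by exists [::]; split=> // i; rewrite /incidence big_nil.
have sum_gt0 : (0 < \sum_(i < m) w i)%N by lia.
have [i0 _|no_i] := pickP 'I_m; last by move: sum_gt0; rewrite big_pred0.
case: (@arg_maxnP _ i0 xpredT w isT) => a _ max_a.
have sumD a' : (\sum_(i < m) w i = w a' + \sum_(i < m | i != a') w i)%N.
  by rewrite (bigD1 a').
have [j /andP[ja wj]] : exists j, (j != a) && (0 < w j)%N.
  apply/existsP; apply: contraT => /existsPn no.
  have := leh a; rewrite (sumD a) big1 ?addn0; first by lia.
  by move=> i nia; have := no i; rewrite nia; case: (w i).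
case: (@arg_maxnP _ j (fun i => i != a) w ja) => b nba max_b.
have wb : (0 < w b)%N by apply: leq_trans wj (max_b _ ja).
have wa : (0 < w a)%N by apply: leq_trans wb (max_a b isT).
pose w' i := (w i - (a == i) - (b == i))%N.
have w'E i : w i = (w' i + (a == i) + (b == i))%N.
  rewrite /w'; case: eqVneq => [<-|_]; case: eqVneq => [eba|_]; try lia.
  - by rewrite eba eqxx in nba.
  - by rewrite -eba; lia.
have sum_delta l : (\sum_(i < m) (l == i) = 1)%N.
  rewrite (bigD1 l) //= eqxx big1 // => i; rewrite eq_sym.
  by case: eqP.
have sumE : (\sum_(i < m) w i = \sum_(i < m) w' i + 2)%N.
  by rewrite (eq_bigr _ (fun i _ => w'E i)) 2!big_split /= !sum_delta -addnA.
have [E [size_E loop_E deg_E]] : exists E : seq ('I_m * 'I_m),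
    [/\ size E = h, all (fun e => e.1 != e.2) E
      & forall i, (incidence E i <= w' i)%N].
  apply: IHh; first by lia.
  move=> i; have [eia|nia] := eqVneq i a.
    by have := leh i; rewrite (w'E i) eia eqxx; lia.
  have [eib|nib] := eqVneq i b.
    by have := leh i; rewrite (w'E i) eib eqxx; lia.
  have ewi : w i = w' i by rewrite (w'E i) ![_ == i]eq_sym (negbTE nia) (negbTE nib) !addn0.
  have lei := max_b i nia; have leb := max_a b isT.
  have : (w a + w b + w i <= \sum_(i < m) w i)%N.
    rewrite (sumD a) (bigD1 b) //= (bigD1 i) /=; first by rewrite !addnA leq_addr.
    by rewrite nia nib.
  by have := leh i; lia.
exists ((a, b) :: E); split=> /=; first by rewrite size_E.
  by rewrite eq_sym nba.
by move=> i; rewrite /incidence big_cons (w'E i) /= addnC -addnA leq_add2r; apply: deg_E.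
Qed.

Definition edge_poly (E : seq ('I_m * 'I_m)) : {mpoly F[m]} :=
  \prod_(e <- E) ('X_(e.1) - 'X_(e.2)).

Lemma edge_poly_neq0 E : all (fun e => e.1 != e.2) E -> edge_poly E != 0.
Proof.
move=> /allP loop_E; rewrite /edge_poly prodf_seq_neq0; apply/allP => e /loop_E ne.
apply: contra ne => /= /eqP/(congr1 (mcoeff U_(e.1))).
rewrite mcoeffB !mcoeffXU eqxx mcoeff0 => /eqP; rewrite subr_eq0.
by case: (eqVneq e.2 e.1) => // _; rewrite oner_eq0.
Qed.

Lemma edge_poly_homog E : edge_poly E \is (size E).-homog.
Proof.
rewrite /edge_poly; elim: E => [|e E IHE]; first by rewrite big_nil dhomog1.
rewrite big_cons /= -add1n; apply: dhomogM => //.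
by rewrite rpredB // dhomogX /= mdeg1.
Qed.

Lemma edge_poly_deg E mu i : mu \in msupp (edge_poly E) -> (mu i <= incidence E i)%N.
Proof.
rewrite /edge_poly /incidence; elim: E mu => [|e E IHE] mu.
  by rewrite !big_nil msupp1 inE => /eqP ->; rewrite mnm0E.
rewrite !big_cons => /msuppM_le /allpairsP[[m1 m2] /= [m1in m2in ->]].
rewrite mnmDE leq_add ?IHE //; move: m1in => /msuppB_le.
rewrite mem_cat !msuppX !inE => /orP[] /eqP ->; rewrite mnm1E.
  exact: leq_addr.
exact: leq_addl.
Qed.

(** Each difference of two variables is killed by the sum of the partial derivatives, which
    is a derivation. *)
Lemma edge_poly_deriv E : \sum_(i < m) (edge_poly E)^`M(i) = 0.
Proof.
rewrite /edge_poly; elim: E => [|e E IHE].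
  by rewrite big_nil big1 // => i _; rewrite mderivC.
rewrite big_cons (eq_bigr _ (fun i _ => mderivM i _ _)).
rewrite big_split /= -mulr_sumr IHE mulr0 addr0 -mulr_suml.
have sumX l : \sum_(i < m) ('X_l : {mpoly F[m]})^`M(i) = 1.
  rewrite (bigD1 l) //= mderivX mnm1E eqxx scale1r big1 => [|i nil].
    have -> : (U_(l) - U_(l))%MM = 0%MM :> 'X_{1..m}.
      by apply/mnmP => i; rewrite mnmBE subnn mnm0E.
    by rewrite addr0 mpolyX0.
  by rewrite mderivX mnm1E eq_sym (negbTE nil) scale0r.
by rewrite (eq_bigr _ (fun i _ => mderivB i _ _)) sumrB !sumX subrr mul0r.
Qed.

(** Macaulay duality with divided powers: the coefficient of c at mu is that of the edge
    polynomial at the complementary exponent M - mu, times factorials, and multiplication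
    by the sum of the variables corresponds to the sum of the partial derivatives.  The
    factorials are nonzero since exponents are less than p. *)
Lemma not_inj_mulS_edges d h N : (forall i, 0 < d i <= p)%N ->
  (N + h + m = \sum_(i < m) d i)%N -> (2 * h <= \sum_(i < m) (d i).-1)%N ->
  (forall i, h + (d i).-1 <= \sum_(i < m) (d i).-1)%N -> ~ inj_mulS F d 1 N.
Proof.
move=> dp sumd le2h leh inj; have [E [size_E loop_E deg_E]] := multigraph le2h leh.
pose M := [multinom (d i).-1 | i < m]; pose G := edge_poly E.
have ME i : M i = (d i).-1 by rewrite mnmE.
have mdegM : (mdeg M + m = \sum_(i < m) d i)%N.
  rewrite mdegE -[X in (_ + X)%N]card_ord -sum1_card -big_split.
  by apply: eq_bigr => i _; rewrite /= ME addn1 prednK //; case/andP: (dp i).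
have G_deg nu : G@_nu != 0 -> (nu <= M)%MM.
  rewrite -mcoeff_msupp => nu_in; apply/mnm_lepP => i; rewrite ME.
  exact: leq_trans (edge_poly_deg i nu_in) (deg_E i).
pose fac nu : F := \prod_(i < m) (nu i)`!%:R.
pose c mu := G@_(M - mu) * fac (M - mu)%MM.
have [nu nu_in] : exists nu, G@_nu != 0.
  by exists (mlead G); rewrite mleadc_eq0 edge_poly_neq0.
have le_nu := G_deg _ nu_in.
have subK : (M - (M - nu))%MM = nu.
  by apply/mnmP => i; rewrite !mnmBE subKn //; apply/mnm_lepP.
have dnu : mdeg nu = h.
  by rewrite -size_E; apply: (dhomog_mf (edge_poly_homog E)); rewrite mcoeff_msupp.
have : c (M - nu)%MM = 0; last first.
  rewrite /c subK; apply/eqP; rewrite mulf_neq0 //; apply/prodf_neq0 => i _.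
  apply: natr_fact_neq0; apply: leq_ltn_trans (_ : M i < p)%N.
    by move/mnm_lepP: le_nu.
  by rewrite ME; have := dp i; lia.
apply: (inj c); last 2 first.
- by move=> i; rewrite mnmBE ME; have := dp i; lia.
- by have := congr1 mdeg (submK le_nu); rewrite mdegD dnu; lia.
move=> mu bmu _ /=.
have leM i : (mu i <= M i)%N by rewrite ME; have := bmu i; have := dp i; lia.
have -> : mulS c mu = fac (M - mu)%MM * (\sum_(i < m) G^`M(i))@_(M - mu).
  rewrite raddf_sum mulr_sumr; apply: eq_bigr => i _ /=.
  rewrite mcoeff_deriv /mulX; case: posnP => [mui|mui].
    have [->|/G_deg/mnm_lepP/(_ i)] := eqVneq (G@_(M - mu + U_(i))) 0.
      by rewrite mul0rn mulr0.
    by rewrite mnmDE mnmBE mui subn0 mnm1E eqxx addn1 ltnn.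
  have eM : (M - (mu - U_(i)))%MM = (M - mu + U_(i))%MM.
    apply/mnmP => j; rewrite !(mnmBE, mnmDE, mnm1E); have := leM j.
    by case: eqP => [<-|_]; lia.
  rewrite /c eM -mulr_natr [fac (M - mu)%MM * _]mulrC -mulrA; congr (_ * _).
  rewrite /fac (bigD1 i) //= [in RHS](bigD1 i) //= mnmDE mnm1E eqxx addn1 factS.
  rewrite natrM -mulrA; congr (_ * (_ * _)); apply: eq_bigr => j nji.
  by rewrite mnmDE mnm1E eq_sym (negbTE nji) addn0.
by rewrite edge_poly_deriv mcoeff0 mulr0.
Qed.

End Existence.

(** * Monomial ideals and the extra variable *)

Section MonomialIdeals.
Variables (F : fieldType) (n : nat).
Implicit Types (d : 'I_n -> nat) (P : pred 'I_n) (h : {mpoly F[n]}) (mu : 'X_{1..n}).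

Lemma monomial_ideal_coeff d P (A : 'I_n -> {mpoly F[n]}) mu :
  (forall l, P l -> mu l < d l)%N -> (\sum_(l | P l) A l * 'X_l ^+ d l)@_mu = 0.
Proof.
move=> mu_lt; rewrite raddf_sum big1 // => l Pl /=.
rewrite mulrC mpolyXn mcoeffXM ifF //; apply/negP => /mnm_lepP/(_ l).
by rewrite mulmnE mnm1E eqxx mul1n leqNgt mu_lt.
Qed.

(** The coefficient [A l] gathers the monomials of h for which l is the chosen index with
    a divisible power; this makes it homogeneous when h is. *)
Lemma monomial_ideal_mem d P h :
  (forall mu, (forall l, P l -> mu l < d l)%N -> h@_mu = 0) ->
  exists A : 'I_n -> {mpoly F[n]}, h = \sum_(l | P l) A l * 'X_l ^+ d l /\
    forall l e, h \is e.-homog -> A l != 0 ->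
      exists2 e', A l \is e'.-homog & (e' + d l = e)%N.
Proof.
move=> h0; pose sel (mu : 'X_{1..n}) := [pick l | P l && (d l <= mu l)%N].
pose A l := \sum_(mu <- msupp h | sel mu == Some l)
  h@_mu *: 'X_[mu - U_(l) *+ d l].
have selP mu l : sel mu = Some l -> P l /\ (d l <= mu l)%N.
  by rewrite /sel; case: pickP => // j /andP[] ? ? [<-].
exists A; split=> [|l e /dhomogP homh].
  rewrite {1}[h]mpolyE; transitivity (\sum_(mu <- msupp h)
      \sum_(l | P l && (sel mu == Some l)) h@_mu *: 'X_[F, mu]).
    rewrite big_seq [RHS]big_seq; apply: eq_bigr => mu mu_in.
    case sel_mu: (sel mu) => [l|].
      rewrite (big_pred1 l) // => j; rewrite [RHS]eq_sym.
      have [<-|] := eqVneq l j; first by rewrite eqxx andbT; case: (selP _ _ sel_mu).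
      by move=> nlj; rewrite (_ : _ == _ = false) ?andbF //; apply/eqP => -[/eqP]; apply/negP.
    move: sel_mu mu_in; rewrite /sel; case: pickP => // no _.
    rewrite mcoeff_msupp h0 ?eqxx // => l Pl.
    by move/negbT: (no l); rewrite Pl /= -ltnNge.
  rewrite (exchange_big_dep P) /=; last by move=> mu l _ /andP[].
  apply: eq_bigr => l Pl; rewrite /A mulr_suml.
  apply: eq_big => [mu|mu /andP[_ /eqP sel_mu]]; first by rewrite Pl.
  have [_ le_l] := selP _ _ sel_mu.
  rewrite -scalerAl mpolyXn -mpolyXD submK //; apply/mnm_lepP => j.
  by rewrite mulmnE mnm1E; case: eqP => [<-|_]; rewrite ?mul1n.
have deg_mu mu : mu \in msupp h -> sel mu = Some l ->
    (mdeg (mu - U_(l) *+ d l)%MM + d l = e)%N.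
  move=> /homh <- /selP[_ le_l].
  have le_m : (U_(l) *+ d l <= mu)%MM.
    by apply/mnm_lepP => j; rewrite mulmnE mnm1E; case: eqP => [<-|_]; rewrite ?mul1n.
  by have := congr1 mdeg (submK le_m); rewrite mdegD mdegMn mdeg1 mul1n.
move=> Al0; have led : (d l <= e)%N.
  rewrite leqNgt; apply: contra Al0 => lted; apply/eqP.
  rewrite /A big_seq_cond big1 // => mu /andP[mu_in /eqP sel_mu].
  by have := deg_mu _ mu_in sel_mu; lia.
exists (e - d l)%N; last by rewrite subnK.
rewrite /A big_seq_cond; apply: rpred_sum => mu /andP[mu_in /eqP sel_mu].
by apply: dhomogZ; rewrite dhomogX /= -(deg_mu _ mu_in sel_mu) addnK.
Qed.

End MonomialIdeals.

Section Relations.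
Variables (F : fieldType) (n : nat).
Implicit Types (d : 'I_n.+1 -> nat) (a : 'I_n.+1 -> {mpoly F[n]}).

Lemma sum_lift (V : nmodType) (g : 'I_n.+1 -> V) :
  \sum_(i < n.+1) g i = \sum_(j < n) g (lift ord_max j) + g ord_max.
Proof.
rewrite big_ord_recr /=; congr (_ + _); apply: eq_bigr => j _; congr g.
by apply: val_inj; rewrite /= /bump leqNgt ltn_ord.
Qed.

(** Exponents in n + 1 variables are pairs of an exponent in the first n variables and one
    of the last variable, which takes the place of the linear form f up to sign. *)
Definition extm (mu : 'X_{1..n}) x : 'X_{1..n.+1} :=
  [multinom (if unlift ord_max i is Some j then mu j else x) | i < n.+1].

Lemma extm_lift mu x j : extm mu x (lift ord_max j) = mu j.
Proof. by rewrite mnmE liftK. Qed.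

Lemma extm_max mu x : extm mu x ord_max = x.
Proof. by rewrite mnmE unlift_none. Qed.

Definition lowm (nu : 'X_{1..n.+1}) : 'X_{1..n} :=
  [multinom nu (lift ord_max j) | j < n].

Lemma lowm_ext mu x : lowm (extm mu x) = mu.
Proof. by apply/mnmP => j; rewrite mnmE extm_lift. Qed.

Lemma extm_low nu : extm (lowm nu) (nu ord_max) = nu.
Proof.
by apply/mnmP => i; case: (unliftP ord_max i) => [j|] ->;
  rewrite ?extm_lift ?extm_max ?mnmE.
Qed.

Lemma mdeg_ext mu x : mdeg (extm mu x) = (mdeg mu + x)%N.
Proof.
rewrite !mdegE [LHS](sum_lift (V := nat)) extm_max; congr addn.
by apply: eq_bigr => j _; rewrite extm_lift.
Qed.

Definition lowd d j := d (lift ord_max j).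

Lemma box_ext d mu x : box d (extm mu x) <-> box (lowd d) mu /\ (x < d ord_max)%N.
Proof.
split=> [bmu|[bmu ltx] i].
  split=> [j|]; last by have := bmu ord_max; rewrite extm_max.
  by have := bmu (lift ord_max j); rewrite extm_lift.
case: (unliftP ord_max i) => [j|] ->; rewrite ?extm_max ?extm_lift //.
Qed.

Lemma mulS_ext (c : 'X_{1..n.+1} -> F) mu x : mulS c (extm mu x) =
  mulS (fun nu => c (extm nu x)) mu + (if x is x'.+1 then c (extm mu x') else 0).
Proof.
rewrite /mulS sum_lift; congr (_ + _).
  apply: eq_bigr => j _; rewrite /mulX extm_lift; case: ifP => // _; congr c.
  apply/mnmP => i; rewrite mnmBE mnm1E.
  case: (unliftP ord_max i) => [l|] ->; rewrite ?extm_lift ?extm_max.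
    by rewrite mnmBE mnm1E (inj_eq lift_inj).
  by rewrite eq_sym (negbTE (neq_lift _ _)) subn0.
rewrite /mulX extm_max; case: x => //= x; congr c; apply/mnmP => i.
rewrite mnmBE mnm1E; case: (unliftP ord_max i) => [l|] ->.
  by rewrite !extm_lift (negbTE (neq_lift _ _)) subn0.
by rewrite !extm_max eqxx subn1.
Qed.

End Relations.

(** * Relations as elements killed by the sum of the variables *)

Section Translation.
Variables (F : fieldType) (n : nat).
Implicit Types (d : 'I_n.+1 -> nat) (a : 'I_n.+1 -> {mpoly F[n]}).

Let f : {mpoly F[n]} := \sum_(j < n) 'X_j.

Lemma xf_lift (j : 'I_n) : xf F (lift ord_max j) = 'X_j.
Proof. by rewrite /xf liftK. Qed.

Lemma xf_max : xf F (ord_max : 'I_n.+1) = f.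
Proof. by rewrite /xf unlift_none. Qed.

Lemma in_ideal_but_max d (h : {mpoly F[n]}) :
  in_ideal_but d ord_max h <-> (forall mu, box (lowd d) mu -> h@_mu = 0).
Proof.
split=> [[b ->] mu bmu|h0].
  rewrite big_mkcond sum_lift eqxx addr0 /=.
  have := monomial_ideal_coeff (fun j => b (lift ord_max j)) (P := predT)
    (fun l _ => bmu l).
  rewrite raddf_sum => sum0; rewrite raddf_sum -[RHS]sum0.
  by apply: eq_bigr => j _; rewrite eq_sym neq_lift xf_lift.
have [A [eqh _]] := @monomial_ideal_mem _ _ (lowd d) predT h
  (fun mu bmu => h0 mu (fun l => bmu l isT)).
exists (fun i => if unlift ord_max i is Some j then A j else 0).
rewrite big_mkcond sum_lift eqxx addr0 /= eqh; apply: eq_bigr => j _.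
by rewrite eq_sym neq_lift xf_lift liftK.
Qed.

(** If the last coefficient is in the ideal of the other powers, subtracting Koszul relations
    leaves a relation among powers of variables, and X_j^d_j is a nonzerodivisor modulo
    the other powers; so all the coefficients are in the respective ideals. *)
Lemma non_Koszul_max d a D : is_relation d D a -> non_Koszul d a ->
  exists mu, box (lowd d) mu /\ (a ord_max)@_mu != 0.
Proof.
move=> [_ rel] [i nKi]; apply: NNPP => no.
have max0 : in_ideal_but d ord_max (a ord_max).
  apply/in_ideal_but_max => mu bmu; apply/eqP/negP => /negP nz.
  by apply: no; exists mu.
apply: nKi; case: (unliftP ord_max i) => [j|] -> //.
have [b eb] := max0.
move: eb; rewrite big_mkcond sum_lift eqxx addr0 /= => eb.
pose h l := a (lift ord_max l) + b (lift ord_max l) * f ^+ d ord_max.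
have sum_h : \sum_(l < n) h l * 'X_l ^+ lowd d l = 0.
  rewrite -[RHS]rel sum_lift xf_max eb mulr_suml -big_split; apply: eq_bigr => l _.
  by rewrite /= xf_lift mulrDl eq_sym neq_lift mulrAC.
have h0 (mu : 'X_{1..n}) : (forall l, l != j -> mu l < lowd d l)%N -> (h j)@_mu = 0.
  move=> mu_lt; have := congr1 (mcoeff (U_(j) *+ lowd d j + mu)) sum_h.
  rewrite mcoeff0 (bigD1 j) //= mcoeffD mpolyXn mcoeffMX monomial_ideal_coeff ?addr0 //.
  move=> l nlj; rewrite mnmDE mulmnE mnm1E eq_sym (negbTE nlj) mul0n.
  exact: mu_lt.
have [A [eqh _]] := monomial_ideal_mem h0.
exists (fun i => if unlift ord_max i is Some l then A l else - b (lift ord_max j)).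
rewrite big_mkcond sum_lift neq_lift unlift_none xf_max.
rewrite -[a _](addrK (b (lift ord_max j) * f ^+ d ord_max)) -/(h j) eqh mulNr.
congr (_ - _); rewrite big_mkcond; apply: eq_bigr => l _.
by rewrite (inj_eq lift_inj) liftK xf_lift.
Qed.

(** The element killed by S is sum_x (-f)^(d - 1 - x) g X^x, where d is the last exponent, X
    the last variable and g the last coefficient of the relation: the product by X + f
    telescopes to a multiple of f^d g. *)
Lemma relation_not_inj d D a : (forall i, 0 < d i)%N ->
  is_relation d D a -> non_Koszul d a ->
  exists D', D = D'.+1 /\ ~ inj_mulS F d 1 D'.
Proof.
move=> d0 rel nK; have [mu [bmu nz]] := non_Koszul_max rel nK.
set g := a ord_max in nz; case: rel => homa rel.
have g0 : g != 0 by apply: contraNneq nz => ->; rewrite mcoeff0.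
have [e home eD] := homa ord_max g0.
have dmu : mdeg mu = e by apply: (dhomog_mf home); rewrite mcoeff_msupp.
have dm := d0 ord_max; have edm := prednK dm.
exists (e + (d ord_max).-1)%N; split; first by rewrite -addnS edm.
move=> inj; case/eqP: nz.
pose c nu := ((- f) ^+ ((d ord_max).-1 - nu ord_max) * g)@_(lowm nu).
have -> : g@_mu = c (extm mu (d ord_max).-1).
  by rewrite /c extm_max lowm_ext subnn mul1r.
apply: inj; last 2 first.
- by apply/box_ext; rewrite edm.
- by rewrite mdeg_ext dmu.
move=> nu bnu _ /=; rewrite -(extm_low nu).
have [blow ltx] : box (lowd d) (lowm nu) /\ (nu ord_max < d ord_max)%N.
  by apply/box_ext; rewrite extm_low.
move: (lowm nu) (nu ord_max) blow ltx => {bnu} {}nu x bnu ltx.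
have cE y : (fun nu' => c (extm nu' y)) =1
    (fun nu' => ((- f) ^+ ((d ord_max).-1 - y) * g)@_nu').
  by move=> nu'; rewrite /c extm_max lowm_ext.
rewrite mulS_ext (eq_mulS (cE x)) -mcoeffSM -/f.
have fM k : f * ((- f) ^+ k * g) = - ((- f) ^+ k.+1 * g).
  by rewrite exprS !mulNr opprK mulrA.
rewrite fM mcoeffN; case: x ltx => [|x] ltx; last first.
  rewrite cE -subSn; last by lia.
  by rewrite subSS addNr.
rewrite addr0 subn0 edm exprNn -mulrA -signr_odd mulr_sign.
have fg0 : (f ^+ d ord_max * g)@_nu = 0.
  move: rel; rewrite sum_lift xf_max -/g mulrC => /eqP; rewrite addrC addr_eq0.
  move=> /eqP ->; rewrite mcoeffN.
  rewrite (eq_bigr (fun j => a (lift ord_max j) * 'X_j ^+ lowd d j)).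
    by rewrite monomial_ideal_coeff ?oppr0 // => l _; apply: bnu.
  by move=> j _; rewrite xf_lift.
by case: ifP; rewrite ?mcoeffN fg0 !oppr0.
Qed.

(** Conversely, modulo S the coefficients of an element killed by S with respect to the last
    variable are determined by the top one, g, and f^d g is in the ideal of the other
    powers. *)
Lemma not_inj_relation d D : (forall i, 0 < d i)%N -> ~ inj_mulS F d 1 D ->
  exists a, is_relation d D.+1 a /\ non_Koszul d a.
Proof.
move=> d0 ninj; apply: NNPP => no; apply: ninj => c van mu0 bmu0 dmu0.
apply: NNPP => nz; apply: no.
pose x0 := (d ord_max).-1; have ex0 : x0.+1 = d ord_max by rewrite prednK.
(* The truncation at degree D only makes the sum finite. *)
pose g : {mpoly F[n]} := \sum_(mu : 'X_{1..n < D.+1})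
  ((if (mdeg mu + x0 == D)%N then c (extm mu x0) else 0) *: 'X_[mu]).
have gE (mu : 'X_{1..n}) : (mdeg mu + x0 = D)%N -> g@_mu = c (extm mu x0).
  move=> dmu; rewrite (mcoeff_mpoly (fun nu : 'X_{1..n} =>
    if (mdeg nu + x0 == D)%N then c (extm nu x0) else 0)) ?dmu ?eqxx //.
  by rewrite ltnS -dmu leq_addr.
have homg : g \is (D - x0)%N.-homog.
  apply: rpred_sum => mu _; case: eqP => [dmu|_]; last by rewrite scale0r rpred0.
  by apply: dhomogZ; rewrite dhomogX /= -[X in X == _](addnK x0) dmu.
have step t (mu : 'X_{1..n}) : (t <= x0)%N ->
    (forall nu : 'X_{1..n}, box (lowd d) nu -> (mdeg nu + (x0 - t) = D)%N ->
       ((- f) ^+ t * g)@_nu = c (extm nu (x0 - t))) ->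
    box (lowd d) mu -> (mdeg mu + (x0 - t) = D.+1)%N ->
    ((- f) ^+ t.+1 * g)@_mu = if (x0 - t)%N is x.+1 then c (extm mu x) else 0.
  move=> let_ IH bmu dmu; rewrite exprS -mulrA mulNr mcoeffN mcoeffSM.
  have := van (extm mu (x0 - t)); rewrite mdeg_ext dmu addn1 /= mulS_ext.
  case/(_ _ erefl)/Wrap => [|eq0]; first by apply/box_ext; split=> //; lia.
  apply/eqP; rewrite eq_sym -subr_eq0 opprK addrC; apply/eqP; rewrite -[RHS]eq0.
  congr (_ + _); apply: eq_bigr => j _; rewrite /mulX.
  case: ifP => // /negbT; rewrite -lt0n => muj; apply: IH.
    exact: box_sub.
  by apply/succn_inj; rewrite -addSn mdeg_subU.
have GE t (mu : 'X_{1..n}) : (t <= x0)%N -> box (lowd d) mu ->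
    (mdeg mu + (x0 - t) = D)%N -> ((- f) ^+ t * g)@_mu = c (extm mu (x0 - t)).
  elim: t mu => [|t IHt] mu let_ bmu dmu.
    by rewrite mul1r subn0 gE // -dmu subn0.
  have ext : (x0 - t = (x0 - t.+1).+1)%N by lia.
  rewrite (step _ _ (ltnW let_) _ bmu); first by rewrite ext.
    by move=> nu; apply: IHt; apply: ltnW.
  by rewrite ext addnS dmu.
have h0 (mu : 'X_{1..n}) : box (lowd d) mu -> mdeg mu = D.+1 ->
    (f ^+ d ord_max * g)@_mu = 0.
  move=> bmu dmu; have := step x0 mu (leqnn _).
  rewrite subnn addn0 => /(_ _ bmu dmu)/Wrap[nu bnu dnu|].
    by rewrite GE ?subnn.
  rewrite ex0 exprNn -mulrA -signr_odd mulr_sign; case: ifP => // _.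
  by rewrite mcoeffN => /eqP; rewrite oppr_eq0 => /eqP.
have nKg : ~ in_ideal_but d ord_max g.
  case=> b eg; apply: nz; rewrite -(extm_low mu0).
  have [bl ltx] : box (lowd d) (lowm mu0) /\ (mu0 ord_max < d ord_max)%N.
    by apply/box_ext; rewrite extm_low.
  have dl : (mdeg (lowm mu0) + mu0 ord_max = D)%N by rewrite -mdeg_ext extm_low.
  have subx : (x0 - (x0 - mu0 ord_max) = mu0 ord_max)%N by lia.
  rewrite -subx -GE ?subx ?leq_subr //.
  apply: (proj1 (in_ideal_but_max d ((- f) ^+ (x0 - mu0 ord_max) * g))) bl.
  exists (fun i => (- f) ^+ (x0 - mu0 ord_max) * b i); rewrite eg mulr_sumr.
  by apply: eq_bigr => i _; rewrite mulrA.
have leD : (x0 <= D)%N.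
  rewrite leqNgt; apply/negP => ltD; apply: nKg; exists (fun=> 0).
  rewrite [RHS]big1 => [|i _]; last by rewrite mul0r.
  apply: big1 => mu _; rewrite ifF ?scale0r //; lia.
have homf : f \is 1.-homog by apply: rpred_sum => j _; rewrite dhomogX /= mdeg1.
have homh : f ^+ d ord_max * g \is D.+1.-homog.
  have -> : D.+1 = (1 * d ord_max + (D - x0))%N by lia.
  by apply: dhomogM homg; apply: dhomogMn.
have [|A [hE homA]] := @monomial_ideal_mem _ _ (lowd d) predT (f ^+ d ord_max * g).
  move=> mu bmu; have [dmu|dmu] := eqVneq (mdeg mu) D.+1.
    by apply: h0 => // l; apply: bmu.
  by apply: dhomog_nemf_coeff homh dmu.
exists (fun i => if unlift ord_max i is Some l then - A l else g); split; last first.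
  by exists ord_max; rewrite unlift_none.
split=> [i|].
  case: unliftP => [l|] -> => [|_]; last by exists (D - x0)%N => //; lia.
  rewrite oppr_eq0 => Al0; have [e' home ee] := homA l D.+1 homh Al0.
  by exists e' => //; rewrite rpredN.
rewrite sum_lift unlift_none xf_max [g * _]mulrC hE -big_split big1 // => l _ /=.
by rewrite liftK xf_lift mulNr addNr.
Qed.

Lemma Ep_spec d : (forall i, 0 < d i)%N ->
  [/\ (0 < Ep F d)%N, ~ inj_mulS F d 1 (Ep F d).-1
    & forall D, ~ inj_mulS F d 1 D -> (Ep F d <= D.+1)%N].
Proof.
move=> d0; have [[a [rel nK]] minE] := EpP F d0.
have [D' [eD ninj]] := relation_not_inj d0 rel nK.
split=> [||D /(not_inj_relation d0)]; [by rewrite eD | by rewrite eD | exact: minE].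
Qed.

(** The q-th powers of the coefficients of a relation form a relation, and a monomial of the
    last coefficient outside the ideal gives its q-th power outside the new ideal. *)
Lemma Ep_frobenius p e d : p \in [pchar F] -> (forall i, 0 < d i)%N ->
  (Ep F (fun i => d i * p ^ e) <= p ^ e * Ep F d)%N.
Proof.
set q := (p ^ e)%N => charp d0.
have q0 : (0 < q)%N by rewrite expn_gt0 prime_gt0 ?(pcharf_prime charp).
have qd0 i : (0 < d i * q)%N by rewrite muln_gt0 d0.
have [[a [rel nK]] _] := EpP F d0; have [_ minE] := EpP F qd0.
apply: minE; exists (fun i => a i ^+ q); split.
  case: rel => homa sum_a; split=> [i|].
    rewrite expf_eq0 q0 /= => ai0; have [e1 home eD] := homa i ai0.
    exists (e1 * q)%N; first exact: dhomogMn.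
    by rewrite -mulnDl eD mulnC.
  under eq_bigr => i _ do rewrite exprM -exprMn.
  rewrite -sum_expr_pchar ?pchar_mpoly // sum_a expr0n eqn0Ngt q0.
  by [].
have [mu [bmu nz]] := non_Koszul_max rel nK.
exists ord_max => /in_ideal_but_max/(_ (mu *+ q)%MM); case/(_ _)/Wrap.
  by move=> j; rewrite mulmnE ltn_pmul2r.
rewrite [a ord_max]mpolyE sum_expr_pchar ?pchar_mpoly // raddf_sum /=.
have muin : mu \in msupp (a ord_max) by rewrite mcoeff_msupp.
rewrite (bigD1_seq mu) ?msupp_uniq //= exprZn mcoeffZ mcoeffXn eqxx mulr1 big1 ?addr0.
  by move/eqP; rewrite expf_eq0 q0 /= (negbTE nz).
move=> nu nmu; rewrite exprZn mcoeffZ mcoeffXn.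
case: eqP => [/mnmP eqm|]; last by rewrite mulr0.
case/eqP: nmu; apply/mnmP => j; have := eqm j; rewrite !mulmnE => /eqP.
by rewrite eqn_pmul2r // => /eqP.
Qed.

End Translation.

(** * Minimal degrees of non-Koszul relations *)

Section Degrees.
Variables (F : fieldType) (n : nat).
Implicit Types (d : 'I_n.+1 -> nat).

Lemma Ep_mono d d' : (forall i, 0 < d' i <= d i)%N -> (Ep F d' <= Ep F d)%N.
Proof.
move=> led; have d'0 i : (0 < d' i)%N by case/andP: (led i).
have d0 i : (0 < d i)%N by case/andP: (led i) => /leq_trans; apply.
have [E0 ninj _] := Ep_spec F d0; have [_ _ minE'] := Ep_spec F d'0.
apply: NNPP => no; apply: ninj; apply: (inj_mulS_mono led) => D' leD'.
by apply: NNPP => /minE' leE'; apply: no; lia.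
Qed.

Lemma Ep_incr d i0 : (forall i, 0 < d i)%N ->
  (Ep F (fun i => d i + (i == i0)) <= (Ep F d).+1)%N.
Proof.
move=> d0; have [E0 ninj _] := Ep_spec F d0.
have [|_ _ minE] := @Ep_spec F _ (fun i => d i + (i == i0))%N.
  by move=> i; rewrite addn_gt0 d0.
rewrite -(prednK E0); apply: minE => inj; apply: ninj.
exact: inj_mulS_decr inj.
Qed.

Lemma Ep_add d w : (forall i, 0 < d i)%N ->
  (Ep F (fun i => d i + w i) <= Ep F d + \sum_(i < n.+1) w i)%N.
Proof.
move=> d0; have [s] := ubnP (\sum_(i < n.+1) w i)%N; elim: s w => // s IHs w.
rewrite ltnS => les; have [w0|/forallPn[i0 wi0]] := boolP [forall i, w i == 0%N].
  apply: leq_trans (leq_addr _ _); apply: Ep_mono => i.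
  by rewrite addn_gt0 d0 (eqP (forallP w0 i)) addn0 leqnn.
pose w' i := (w i - (i == i0))%N.
have sumE : (\sum_(i < n.+1) w i = (\sum_(i < n.+1) w' i).+1)%N.
  rewrite (bigD1 i0) //= [in RHS](bigD1 i0) //= /w' eqxx subn1 -addSn.
  rewrite prednK ?lt0n //; congr addn; apply: eq_bigr => i /negbTE ->.
  by rewrite subn0.
have dw0 i : (0 < d i + w' i)%N by rewrite addn_gt0 d0.
apply: leq_trans (_ : Ep F (fun i => d i + w' i + (i == i0)) <= _)%N.
  apply: Ep_mono => i; rewrite addn_gt0 d0 /w' /=.
  by case: eqP => [->|_]; lia.
apply: leq_trans (Ep_incr _ dw0) _; rewrite sumE addnS ltnS.
by apply: IHs; rewrite -sumE.
Qed.

Variable p : nat.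
Hypothesis charp : p \in [pchar F].

(** The lower bound is [inj_mulS_lefschetz] with t = 1.  For the upper bound, the edges of a
    multigraph with h = (sum_j d j - (n + 1)) / 2 edges give the first value, and S^(p-1)
    gives p; the latter is nonzero in the quotient when p is the smaller value. *)
Lemma Ep_small d : (forall i, 0 < d i <= p)%N ->
  (forall i, 2 * d i + n <= \sum_(j < n.+1) d j + 2)%N ->
  Ep F d = minn (uphalf (\sum_(j < n.+1) d j - n + 1)) p.
Proof.
move=> dp bal; have d0 i : (0 < d i)%N by case/andP: (dp i).
have p1 : (1 < p)%N by rewrite prime_gt1 ?(pcharf_prime charp).
have [E0 ninj minE] := Ep_spec F d0; set S := (\sum_(j < n.+1) d j)%N in bal *.
have sum_pred : (\sum_(i < n.+1) (d i).-1 + n.+1 = S)%N.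
  rewrite -[X in (_ + X)%N]card_ord -sum1_card -big_split.
  by apply: eq_bigr => i _; rewrite /= addn1 prednK.
have half_up x : uphalf x = (x - x./2)%N by rewrite uphalf_half -{2}(odd_double_half x); lia.
apply/eqP; rewrite eqn_leq; apply/andP; split; last first.
  rewrite leqNgt; apply/negP; rewrite leq_min => /andP[lt_half lt_p].
  apply: ninj; apply: (inj_mulS_lefschetz charp d0); first by lia.
  rewrite -/S; move: lt_half; rewrite half_up.
  have := odd_double_half (S - n + 1); have := leq_b1 (odd (S - n + 1)).
  by lia.
have geS : (n < S)%N by rewrite -sum_pred; lia.
have eU : uphalf (S - n + 1) = (S - n.+1 - (S - n.+1)./2).+1.
  have -> : (S - n + 1 = (S - n.+1).+2)%N by lia.
  by rewrite /= half_up.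
have leU : (Ep F d <= uphalf (S - n + 1))%N.
  rewrite eU; apply: minE; apply: (not_inj_mulS_edges charp (h := (S - n.+1)./2) dp).
  - by rewrite -/S; have := odd_double_half (S - n.+1); lia.
  - by have := odd_double_half (S - n.+1); lia.
  - move=> i; have := bal i; have := d0 i; have := odd_double_half (S - n.+1).
    by have := leq_b1 (odd (S - n.+1)); lia.
rewrite leq_min leU; have [leUp|ltpU] := leqP (uphalf (S - n + 1)) p.
  exact: leq_trans leU leUp.
rewrite -[X in (_ <= X)%N](prednK (ltnW p1)); apply: minE.
apply: (not_inj_mulS_pchar charp dp); rewrite -/S.
by move: ltpU; rewrite eU; have := odd_double_half (S - n.+1); lia.
Qed.

End Degrees.

(** Replacing K by the nearest of k and k + 1 lowers the cost by at least q per unit. *)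
Lemma cost_clamp q k r K b : (r < q)%N -> b = (k < K)%N ->
  (q * (k + b) + 2 * (if b == false then r else 0)
     + q * ((K - (k + b)) + (k + b - K)) <= cost q (k * q + r) K)%N
  /\ odd K = odd (k + b + ((K - (k + b)) + (k + b - K))).
Proof.
move=> ltr ->; case: (ltnP k K) => [ltk|lek]; split.
- have -> : (k + true - K = 0)%N by lia.
  by rewrite muln0 !addn0 -mulnDr addn1 subnKC // /cost leq_addr.
- by congr odd; lia.
- have -> : (K - (k + false) = 0)%N by lia.
  rewrite eqxx addn0 add0n /cost [(k * q)%N]mulnC -addnBAC ?leq_mul2l ?lek ?orbT //.
  by rewrite -mulnBr; have := subnKC lek; move: (k - K)%N => l <-; lia.
- rewrite addn0 (_ : K - k = 0)%N ?add0n ?oddD ?oddB //; last by lia.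
  by case: (odd k); case: (odd K).
Qed.

Section Main.
Variables (p : nat) (F : fieldType) (n : nat).
Hypotheses (charp : p \in [pchar F]) (n3 : (3 <= n)%N).
Variables (e : nat) (k r : 'I_n.+1 -> nat).
Let q := (p ^ e)%N.
Let d i := (k i * q + r i)%N.
Hypotheses (ltr : forall i, (r i < q)%N) (ltk : forall i, (0 < k i < p)%N).
Hypothesis bal : forall i, (2 * k i + n <= \sum_(j < n.+1) k j + 1)%N.
Implicit Types (eps : {ffun 'I_n.+1 -> bool}).

Let k0 i : (0 < k i)%N. Proof. by case/andP: (ltk i). Qed.
Let q0 : (0 < q)%N.
Proof. by rewrite expn_gt0 prime_gt0 ?(pcharf_prime charp). Qed.
Let d0 i : (0 < d i)%N. Proof. by rewrite addn_gt0 muln_gt0 k0 q0. Qed.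

(** A corner may violate the condition on its exponents by one, which [Ep_small] allows. *)
Lemma Ep_corner eps : Ep F (fun i => k i + eps i)%N
  = minn (uphalf (\sum_(i < n.+1) (k i + eps i) - n + 1)) p.
Proof.
apply: (Ep_small charp) => i; have := ltk i; first by case: (eps i); lia.
move=> _; have := bal i.
have -> : (\sum_(j < n.+1) (k j + eps j) = \sum_(j < n.+1) k j
    + \sum_(j < n.+1) eps j)%N by rewrite big_split.
have : (eps i <= \sum_(j < n.+1) eps j)%N by rewrite (bigD1 i) //= leq_addr.
by have := leq_b1 (eps i); lia.
Qed.

Lemma Ep_le_corner eps : (Ep F d <= q * Ep F (fun i => k i + eps i)
  + \sum_(i < n.+1 | eps i == false) r i)%N.
Proof.
have ke0 i : (0 < k i + eps i)%N by rewrite addn_gt0 k0.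
have qke0 i : (0 < (k i + eps i) * q)%N by rewrite muln_gt0 ke0.
pose w i := if eps i == false then r i else 0%N.
apply: leq_trans (_ : Ep F (fun i => (k i + eps i) * q + w i) <= _)%N.
  apply: Ep_mono => i; rewrite d0 /= /d /w mulnDl; have := ltr i.
  by case: (eps i); rewrite /= ?mul1n ?mul0n; lia.
apply: leq_trans (Ep_add F w qke0) _; rewrite [X in (_ <= _ + X)%N]big_mkcond.
by rewrite leq_add2r; apply: Ep_frobenius.
Qed.

(** Either the degree is at least p q, which bounds the value at the corner with all eps
    equal to 1, or some vector K violates [below_corners].  Clamping K into the cell of k
    gives a corner; if this changes the parity of the sum it also lowers the cost by at
    least q, which accounts for the rounding in [uphalf]. *)
Lemma Ep_ge_corner : exists eps, (q * Ep F (fun i => k i + eps i)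
  + \sum_(i < n.+1 | eps i == false) r i <= Ep F d)%N.
Proof.
have [lepq|ltpq] := leqP (p * q) (Ep F d).
  exists [ffun=> true]; rewrite Ep_corner.
  have -> : (\sum_(i < n.+1 | [ffun=> true] i == false) r i = 0)%N.
    by apply: big_pred0 => i; rewrite ffunE.
  by rewrite addn0 mulnC; apply: leq_trans lepq; rewrite leq_mul2r geq_minr orbT.
have [E0 ninj _] := Ep_spec F d0.
have [K [oddK leK]] : exists K : 'I_n.+1 -> nat, odd (\sum_(i < n.+1) K i) = odd n.+1 /\
    (2 * q + \sum_(i < n.+1) cost q (d i) (K i) <= 2 * Ep F d + q * n.+1)%N.
  apply: NNPP => no; apply: ninj.
  apply: (inj_mulS_below_corners charp) => //; rewrite -/q prednK //.
  move=> K oddK; rewrite ltnNge; apply/negP => leK; apply: no; by exists K.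
pose eps : {ffun 'I_n.+1 -> bool} := [ffun i => (k i < K i)%N].
pose kb i := (k i + eps i)%N; pose del i := ((K i - kb i) + (kb i - K i))%N.
have cl i : (q * kb i + 2 * (if eps i == false then r i else 0) + q * del i
    <= cost q (d i) (K i))%N /\ odd (K i) = odd (kb i + del i).
  by apply: cost_clamp; rewrite ?ffunE.
exists eps; rewrite Ep_corner -/q.
have odd_sumK : odd (\sum_(i < n.+1) kb i) (+) odd (\sum_(i < n.+1) del i) = odd n.+1.
  by rewrite -oddK -oddD -big_split; apply: odd_sum => i; case: (cl i).
have : (q * (\sum_(i < n.+1) kb i) + 2 * (\sum_(i < n.+1 | eps i == false) r i)
    + q * (\sum_(i < n.+1) del i) <= \sum_(i < n.+1) cost q (d i) (K i))%N.
  rewrite [X in (_ + 2 * X + _)%N]big_mkcond !big_distrr -!big_split /=.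
  by apply: leq_sum => i _; case: (cl i).
have leS : (n < \sum_(i < n.+1) kb i)%N.
  rewrite -[X in (X <= _)%N]card_ord -sum1_card; apply: leq_sum => i _.
  by rewrite addn_gt0 k0.
rewrite -/kb; move: leS odd_sumK leK.
move: (\sum_(i < n.+1) kb i)%N (\sum_(i < n.+1) del i)%N => S T.
move: (\sum_(i < n.+1) _)%N (\sum_(i < n.+1 | _) r i)%N => C rho leS odd_sum leK leC.
have key : (2 * (q * uphalf (S - n + 1)) + 2 * rho <= 2 * Ep F d)%N.
  have [x ex] : exists x, S = (x + n.+1)%N by exists (S - n.+1)%N; lia.
  have -> : (S - n + 1 = x.+2)%N by lia.
  have [y [ey le_y]] : exists y, uphalf x.+2 = y /\ (2 * y <= x + 2 + T)%N.
    exists (uphalf x.+2); split=> //; rewrite uphalf_half.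
    have := odd_double_half x.+2; move: odd_sum; rewrite ex oddD /=.
    by case: T {leC} => [|T]; case: (odd x); case: (odd n); lia.
  have := leq_mul (leqnn q) le_y; rewrite ey; subst S.
  by move: leC leK; rewrite !mulnDr !mulnS; lia.
apply: leq_trans (_ : q * uphalf (S - n + 1) + rho <= _)%N; last by lia.
by rewrite leq_add2r leq_mul2l geq_minl orbT.
Qed.

End Main.

Theorem theorem1p6 (p : nat) (k : fieldType) (n : nat)
    (hp : prime p) (hk : p \in [pchar k]) (hn : (3 <= n)%N) :
  (forall (e : nat) (r kk : 'I_n.+1 -> nat),
     let q := (p ^ e)%N in
     (forall i, (r i <= q - 1)%N) ->
     (forall i, (1 <= kk i <= p - 1)%N) ->
     (forall i, (kk i <= (\sum_(j < n.+1) kk j - n + 1) %/ 2)%N) ->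
     Ep k (fun i => (kk i * q + r i)%N)
     = nat_min (fun m => exists eps : {ffun 'I_n.+1 -> bool},
         m = (q * Ep k (fun i => (kk i + eps i)%N)
              + \sum_(i < n.+1 | eps i == false) r i)%N))
  /\
  (forall kappa : 'I_n.+1 -> nat,
     (forall i, (1 <= kappa i <= p)%N) ->
     (forall i, (kappa i <= (\sum_(j < n.+1) kappa j - n + 1) %/ 2)%N) ->
     Ep k kappa
     = minn (uphalf (\sum_(j < n.+1) kappa j - n + 1)) p).
Proof.
have large (w : 'I_n.+1 -> nat) : (forall i, 0 < w i)%N ->
    (n < \sum_(j < n.+1) w j)%N.
  move=> w0; rewrite -[X in (X <= _)%N]card_ord -sum1_card.
  by apply: leq_sum => i _.
split=> [e r kk q ler lek bal|kappa lek bal].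
  have q0 : (0 < q)%N by rewrite expn_gt0 prime_gt0.
  have ltr i : (r i < q)%N by have := ler i; lia.
  have ltk i : (0 < kk i < p)%N by have := lek i; have := prime_gt0 hp; lia.
  have bal' i : (2 * kk i + n <= \sum_(j < n.+1) kk j + 1)%N.
    have := bal i; rewrite leq_divRL // => le2.
    by have := large kk (fun j => proj1 (andP (ltk j))); lia.
  set P := (P in nat_min P).
  have [[eps ->] minP] : is_min_of P (nat_min P).
    by apply: nat_minP; exists (q * Ep k (fun i => kk i + [ffun=> true] i)
      + \sum_(i < n.+1 | [ffun=> true] i == false) r i)%N; exists [ffun=> true].
  apply/eqP; rewrite eqn_leq Ep_le_corner //=.
  have [eps' le'] := Ep_ge_corner hk hn ltr ltk bal'.
  by apply: leq_trans le'; apply: minP; exists eps'.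
apply: (Ep_small hk lek) => i; have := bal i; rewrite leq_divRL // => le2.
by have := large kappa (fun j => proj1 (andP (lek j))); lia.
Qed.
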